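(* Let $\Gamma\subseteq \mathrm{SL}_2(\mathbb R)$ be a commensurable subgroup, let $k\in\frac12\mathbb Z$, and let $\nu$ be a consistent finite weight $k$ multiplier for $\Gamma$. Let $(f^{(\nu)}_{k,m})_{m\in I^{(\nu)}_k}$ be the row-reduced canonical basis of $M^{(\infty)}_k(\Gamma,\nu)$, with expansions $$f^{(\nu)}_{k,m}(z)=q^{-m}+\sum_{n\in \mathbb Z^{(\nu)},\ -n\notin I^{(\nu)}_k}a^{(\nu)}_k(m,n)q^n ,$$ and let $(g^{(\overline\nu)}_{2-k,n})_{n\in J^{(\overline\nu)}_{2-k}}$ be the row-reduced canonical basis of $\widehat M^{(\infty)}_{2-k}(\Gamma,\overline\nu)$, with expansions $$g^{(\overline\nu)}_{2-k,n}(z)=q^{-n}+\sum_{m\in \mathbb Z^{(\overline\nu)},\ -m\notin J^{(\overline\nu)}_{2-k}}b^{(\overline\nu)}_{2-k}(n,m)q^m .$$ Then for every $m\in I^{(\nu)}_k$ and every $n\in J^{(\overline\nu)}_{2-k}$, $$a^{(\nu)}_k(m,n)=-\,b^{(\overline\nu)}_{2-k}(n,m).$$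
   Context: **Groups and multipliers.** $\mathbb H$ is the upper half-plane and $q^r=e^{2\pi i r z}$. A *commensurable subgroup* is a subgroup $\Gamma\subseteq \mathrm{SL}_2(\mathbb R)$ such that $\Gamma\cap \mathrm{SL}_2(\mathbb Z)$ has finite index in both $\Gamma$ and $\mathrm{SL}_2(\mathbb Z)$. Its cusps are the elements of $\Gamma\backslash(\mathbb Q\cup\{\infty\})$. For $\gamma=\begin{pmatrix}a&b\\c&d\end{pmatrix}\in \mathrm{GL}_2^+(\mathbb R)$ put $j(\gamma,z)=\det(\gamma)^{-1/2}(cz+d)$; for $k\in\frac12+\mathbb Z$, $j^k=(\sqrt j)^{2k}$ with the principal square root. Let $\mathfrak G_k$ be the group of pairs $(\gamma,\phi)$ with $\gamma=\begin{pmatrix}a&b\\c&d\end{pmatrix}\in \mathrm{GL}_2^+(\mathbb R)$ and $\phi$ holomorphic on $\mathbb H$ with $|\phi(z)|=\det(\gamma)^{-k/2}|cz+d|^k$, with product $(\gamma,\phi(z))(\mu,\psi(z))=(\gamma\mu,\phi(\mu z)\psi(z))$. A *consistent weight $k$ multiplier* for $\Gamma$ is a function $\nu:\Gamma\to\mathbb C^\times$ such that $\{(\gamma,\nu(\gamma)j(\gamma,z)^k):\gamma\in\Gamma\}$ is a subgroup of $\mathfrak G_k$ and $\nu(\gamma)j(\gamma,z)^k=1$ for all scalar $\gamma\in\Gamma$; it is *finite* if its image is finite. Then $\overline\nu$ is a consistent finite weight $2-k$ multiplier. Slash operator: $(f|_k\gamma)(z)=j(\gamma,z)^{-k}f(\gamma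 z)$. A function $f$ is modular of weight $k$ for $(\Gamma,\nu)$ if $f(\gamma z)=\nu(\gamma)j(\gamma,z)^kf(z)$ for all $\gamma\in\Gamma$. **Spaces.** $M_k^!(\Gamma,\nu)$: weight $k$ modular forms for $(\Gamma,\nu)$ holomorphic on $\mathbb H$ and meromorphic at all cusps (weakly holomorphic forms). $M_k(\Gamma,\nu)$: those holomorphic at all cusps. $S_k(\Gamma,\nu)$: those vanishing at all cusps. $M_k^{(\infty)}(\Gamma,\nu)\subseteq M_k^!(\Gamma,\nu)$: forms with poles allowed only at the cusp $\infty$. $\widehat M_k^{(\infty)}(\Gamma,\nu)\subseteq M_k^{(\infty)}(\Gamma,\nu)$: those which vanish at every cusp other than $\infty$. **Exponents.** The upper triangular elements of $\Gamma$ all have the form $\pm\begin{pmatrix}1&r\\0&1\end{pmatrix}$, and the set of occurring $r$ is $w\mathbb Z$ for a unique rational $w>0$. Let $\varsigma\in[0,1)$ be the rational number such that $f(z+w)=e^{2\pi i\varsigma}f(z)$ for every weight $k$ modular $f$ for $(\Gamma,\nu)$; that is, $e^{2\pi i\varsigma}=\nu(T)$ if $T=\begin{pmatrix}1&w\\0&1\end{pmatrix}\in\Gamma$, and $e^{2\pi i\varsigma}=\nu(T)i^{2k}$ with $T=\begin{pmatrix}-1&-w\\0&-1\end{pmatrix}\in\Gamma$ otherwise. Set $\mathbb Z^{(\nu)}=\{(n+\varsigma)/w:n\in\mathbb Z\}$; this is the set of exponents allowed in expansions $f=\sum_{n\in\mathbb Z^{(\nu)}}a(n)q^n$ at $\infty$.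 One has $\mathbb Z^{(\overline\nu)}=-\mathbb Z^{(\nu)}$ (with weight $2-k$ for $\overline\nu$). Subscripts $>0,\ge0$ denote the positive, nonnegative elements. **Index sets and canonical bases.** Let $\widetilde I^{(\nu)}_k\subseteq\mathbb Z^{(\nu)}_{\ge0}$ (resp. $\widetilde J^{(\nu)}_k\subseteq\mathbb Z^{(\nu)}_{>0}$) be the finite set of orders of vanishing at $\infty$ (leading exponents of $q$) of nonzero elements of $M_k(\Gamma,\nu)$ (resp. $S_k(\Gamma,\nu)$), i.e. the index sets of the reduced echelon bases of these spaces. Define $I^{(\nu)}_k$ and $J^{(\nu)}_k$ by the disjoint unions $$I^{(\nu)}_k\sqcup\widetilde J^{(\overline\nu)}_{2-k}=\mathbb Z^{(\overline\nu)}_{>0}\sqcup(-\widetilde I^{(\nu)}_k),\qquad J^{(\nu)}_k\sqcup\widetilde I^{(\overline\nu)}_{2-k}=\mathbb Z^{(\overline\nu)}_{\ge0}\sqcup(-\widetilde J^{(\nu)}_k).$$ Then $\mathbb Z^{(\nu)}=(-I^{(\nu)}_k)\sqcup J^{(\overline\nu)}_{2-k}$. The row-reduced canonical basis of $M^{(\infty)}_k(\Gamma,\nu)$ is the basis indexed by $I^{(\nu)}_k$ whose $m$-th element is the unique element of that space of the form $q^{-m}+\sum_{n\in\mathbb Z^{(\nu)},-n\notin I^{(\nu)}_k}a^{(\nu)}_k(m,n)q^n$; the row-reduced canonical basis of $\widehat M^{(\infty)}_k(\Gamma,\nu)$ is the basis indexed by $J^{(\nu)}_k$ whose $n$-th element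 is the unique element of that space of the form $q^{-n}+\sum_{m\in\mathbb Z^{(\nu)},-m\notin J^{(\nu)}_k}b^{(\nu)}_k(n,m)q^m$. *)

(* Defs.v *)
From HB Require Import structures.
From mathcomp Require Import all_boot all_order all_algebra.
From mathcomp Require Import complex.
From mathcomp Require Import boolp classical_sets functions cardinality reals.
From mathcomp Require Import topology normedtype sequences derive exp trigo.

Set Implicit Arguments.
Unset Strict Implicit.
Unset Printing Implicit Defensive.

Import Order.TTheory GRing.Theory Num.Theory.
Import numFieldNormedType.Exports.

Local Open Scope classical_set_scope.
Local Open Scope complex_scope.
Local Open Scope ring_scope.

(* Half-integral weights k are given by the integer [k2] = 2k throughout; in
   particular the weight 2 - k is [4 - k2]. *)

Section Groups.
Variable R : realType.
Local Notation C := R[i].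
Local Notation M2 := 'M[R]_2.

Definition SL2 : set M2 := [set g | \det g = 1].

Definition SL2Z : set M2 :=
  [set g | SL2 g /\ forall i j, g i j \is a Num.int].

Definition matrix_subgroup (G : set M2) : Prop :=
  [/\ G 1%:M,
      forall g h, G g -> G h -> G (g *m h) &
      forall g, G g -> G (invmx g)].

(* H has finitely many left cosets gH in G. *)
Definition finite_index (G H : set M2) : Prop :=
  finite_set [set [set g *m h | h in H] | g in G].

Definition commensurable (G : set M2) : Prop :=
  [/\ G `<=` SL2, matrix_subgroup G,
      finite_index G (G `&` SL2Z) & finite_index SL2Z (G `&` SL2Z)].

Definition transl (r : R) : M2 := 1%:M + r *: delta_mx 0 1.

(* [complex.Im], not [Num.Im]: the latter is complex valued. *)
Definition uhp : set C := [set z : C | 0 < complex.Im z].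

(* Functions on the upper half-plane are represented by functions on C, of
   which only the restriction to [uhp] is ever considered. *)
Definition agree (f g : C -> C) : Prop := forall z, uhp z -> f z = g z.

Definition holomorphic (f : C -> C) : Prop :=
  forall z, uhp z -> derivable (f : C^o -> C^o) z 1.

Definition cden (g : M2) (z : C) : C := (g 1 0)%:C * z + (g 1 1)%:C.

Definition mobius (g : M2) (z : C) : C :=
  ((g 0 0)%:C * z + (g 0 1)%:C) / cden g z.

(* Action on the real projective line, [None] being the point at infinity. *)
Definition mobius_bd (g : M2) (s : option R) : option R :=
  let: (num, den) :=
    if s is Some x then (g 0 0 * x + g 0 1, g 1 0 * x + g 1 1)
    else (g 0 0, g 1 0) in
  if den == 0 then None else Some (num / den).

Definition jfactor (g : M2) (z : C) : C :=
  ((Num.sqrt (\det g))^-1)%:C * cden g z.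

(* j(g,z)^k = (sqrt j)^(2k); [sqrtc] is the principal square root, unlike
   [sqrtC], whose values have arguments in [0,pi). *)
Definition jpow (k2 : int) (g : M2) (z : C) : C := sqrtc (jfactor g z) ^ k2.

Definition wt (k2 : int) : R := k2%:~R / 2.

(* The group G_k of pairs (g, phi), up to agreement of phi on [uhp]. *)
Definition Gk (k2 : int) : set (M2 * (C -> C)) :=
  [set x | [/\ 0 < \det x.1, holomorphic x.2 &
     forall z, uhp z ->
       `|x.2 z| = ((\det x.1) `^ (- wt k2 / 2)
                   * complex.Re `|cden x.1 z| `^ wt k2)%:C]].

Definition Gk_eq (x y : M2 * (C -> C)) : Prop := x.1 = y.1 /\ agree x.2 y.2.

Definition Gk_one : M2 * (C -> C) := (1%:M, fun=> 1).

Definition Gk_mul (x y : M2 * (C -> C)) : M2 * (C -> C) :=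
  (x.1 *m y.1, fun z => x.2 (mobius y.1 z) * y.2 z).

Definition Gk_inv (x : M2 * (C -> C)) : M2 * (C -> C) :=
  (invmx x.1, fun z => (x.2 (mobius (invmx x.1) z))^-1).

Definition Gk_subgroup (k2 : int) (S : set (M2 * (C -> C))) : Prop :=
  [/\ S `<=` Gk k2,
      exists2 e, S e & Gk_eq e Gk_one,
      forall x y, S x -> S y -> exists2 w, S w & Gk_eq w (Gk_mul x y) &
      forall x, S x -> exists2 w, S w & Gk_eq w (Gk_inv x)].

(* Multipliers are functions on all matrices of which only the restriction to
   the group is considered. *)
Definition consistent_multiplier (k2 : int) (G : set M2) (nu : M2 -> C) : Prop :=
  [/\ forall g, G g -> nu g != 0,
      Gk_subgroup k2 [set (g, fun z => nu g * jpow k2 g z) | g in G] &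
      forall g, G g -> is_scalar_mx g ->
        forall z, uhp z -> nu g * jpow k2 g z = 1].

Definition finite_multiplier (G : set M2) (nu : M2 -> C) : Prop :=
  finite_set [set nu g | g in G].

Definition conj_multiplier (nu : M2 -> C) : M2 -> C := fun g => conjc (nu g).

Definition slash (k2 : int) (f : C -> C) (g : M2) : C -> C :=
  fun z => (jpow k2 g z)^-1 * f (mobius g z).

Definition modular (k2 : int) (G : set M2) (nu : M2 -> C) (f : C -> C) : Prop :=
  forall g, G g -> forall z, uhp z -> f (mobius g z) = nu g * jpow k2 g z * f z.

(* qpow r z = q^r = exp(2 pi i r z) *)
Definition qpow (r : rat) (z : C) : C :=
  let t := 2 * pi * ratr r in
  (expR (- (t * complex.Im z)))%:C
  * (cos (t * complex.Re z) +i* sin (t * complex.Re z)).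

(* f = \sum_x a(x) q^x on the upper half-plane, where the support of
   a : rat -> C is bounded below and has bounded denominators N. *)
Definition qexpansion (f : C -> C) (a : rat -> C) : Prop :=
  exists (N : nat) (n0 : int),
    let x (i : nat) : rat := (n0 + i%:Z)%:~R / N%:R in
    [/\ (0 < N)%N,
        forall y, a y != 0 -> exists i, y = x i &
        forall z, uhp z ->
          series (fun i => a (x i) * qpow (x i) z : C^o) @ \oo --> (f z : C^o)].

(* Elements of Q u {oo} are of type [option rat]. The expansions of f at s all
   have exponents in E, s being moved from oo by elements of SL_2(Z). *)
Definition expands_at (k2 : int) (f : C -> C) (s : option rat) (E : set rat) :
    Prop :=
  forall g, SL2Z g -> mobius_bd g None = omap ratr s ->
    exists2 a, qexpansion (slash k2 f g) a & forall x, a x != 0 -> E x.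

Definition meromorphic_at k2 f s := expands_at k2 f s setT.
Definition holomorphic_at k2 f s := expands_at k2 f s [set x | 0 <= x].
Definition vanishes_at k2 f s := expands_at k2 f s [set x | 0 < x].

(* s represents the cusp oo of G \ (Q u {oo}) *)
Definition infinite_cusp (G : set M2) (s : option rat) : Prop :=
  exists2 g, G g & mobius_bd g None = omap ratr s.

Definition weakly_holomorphic_forms k2 G nu : set (C -> C) :=
  [set f | [/\ holomorphic f, modular k2 G nu f &
               forall s, meromorphic_at k2 f s]].

Definition modular_forms k2 G nu : set (C -> C) :=
  [set f | weakly_holomorphic_forms k2 G nu f /\
           forall s, holomorphic_at k2 f s].

Definition cusp_forms k2 G nu : set (C -> C) :=
  [set f | weakly_holomorphic_forms k2 G nu f /\
           forall s, vanishes_at k2 f s].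

Definition Minf k2 G nu : set (C -> C) :=
  [set f | weakly_holomorphic_forms k2 G nu f /\
           forall s, ~ infinite_cusp G s -> holomorphic_at k2 f s].

Definition Mhatinf k2 G nu : set (C -> C) :=
  [set f | Minf k2 G nu f /\
           forall s, ~ infinite_cusp G s -> vanishes_at k2 f s].

(* w is the positive generator of the group of those r for which some
   +-(1 r; 0 1) lies in G. *)
Definition is_width (G : set M2) (w : rat) : Prop :=
  0 < w /\ forall r : R, (G (transl r) \/ G (- transl r)) <->
                         exists n : int, r = n%:~R * ratr w.

Definition is_shift (k2 : int) (G : set M2) (nu : M2 -> C) (w sh : rat) : Prop :=
  let T := transl (ratr w) in
  [/\ 0 <= sh < 1,
      G T -> qpow sh 1 = nu T &
      ~ G T -> qpow sh 1 = nu (- T) * 'i%C ^ k2].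

Definition exponents (k2 : int) (G : set M2) (nu : M2 -> C) : set rat :=
  [set x | exists (w sh : rat) (n : int),
     [/\ is_width G w, is_shift k2 G nu w sh & x = (n%:~R + sh) / w]].

Definition order_at_infty (f : C -> C) (r : rat) : Prop :=
  exists a, [/\ qexpansion f a, a r != 0 & forall x, x < r -> a x = 0].

Definition orders (V : set (C -> C)) : set rat :=
  [set r | exists f, [/\ V f, ~ agree f (fun=> 0) & order_at_infty f r]].

Definition Itilde k2 G nu : set rat :=
  [set x | exponents k2 G nu x /\ 0 <= x] `&` orders (modular_forms k2 G nu).

Definition Jtilde k2 G nu : set rat :=
  [set x | exponents k2 G nu x /\ 0 < x] `&` orders (cusp_forms k2 G nu).

Definition Iset k2 G nu : set rat :=
  let nub := conj_multiplier nu in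
  ([set x | exponents (4 - k2) G nub x /\ 0 < x]
     `|` [set - x | x in Itilde k2 G nu])
  `\` Jtilde (4 - k2) G nub.

Definition Jset k2 G nu : set rat :=
  let nub := conj_multiplier nu in
  ([set x | exponents (4 - k2) G nub x /\ 0 <= x]
     `|` [set - x | x in Jtilde k2 G nu])
  `\` Itilde (4 - k2) G nub.

(* [Iset] and [Jset] are the solutions of the disjoint unions
   I_k u Jtilde_{2-k} = Z_{>0} u (- Itilde_k),
   J_k u Itilde_{2-k} = Z_{>=0} u (- Jtilde_k). *)
Lemma Iset_disjoint_union k2 G nu (nub := conj_multiplier nu) :
  let P := [set x | exponents (4 - k2) G nub x /\ 0 < x] in
  let N := [set - x | x in Itilde k2 G nu] in
  [/\ Iset k2 G nu `|` Jtilde (4 - k2) G nub = P `|` N,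
      Iset k2 G nu `&` Jtilde (4 - k2) G nub = set0 &
      P `&` N = set0].
Proof.
split.
- by rewrite setUC setDUK// => x [[Jx0 Jx] _]; left.
- by rewrite setDKI.
- apply/seteqP; split=> // x [[_ x0] [y [[_ y0] _] yx]].
  by move: x0; rewrite -yx oppr_gt0 ltNge y0.
Qed.

Lemma Jset_disjoint_union k2 G nu (nub := conj_multiplier nu) :
  let P := [set x | exponents (4 - k2) G nub x /\ 0 <= x] in
  let N := [set - x | x in Jtilde k2 G nu] in
  [/\ Jset k2 G nu `|` Itilde (4 - k2) G nub = P `|` N,
      Jset k2 G nu `&` Itilde (4 - k2) G nub = set0 &
      P `&` N = set0].
Proof.
split.
- by rewrite setUC setDUK// => x [[Jx0 Jx] _]; left.
- by rewrite setDKI.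
- apply/seteqP; split=> // x [[_ x0] [y [[_ y0] _] yx]].
  by move: x0; rewrite -yx oppr_ge0 leNgt y0.
Qed.

(* h = q^(-m) + \sum_(x in E, - x notin I) c(x) q^x *)
Definition reduced_form (E I : set rat) (m : rat) (h : C -> C) (c : rat -> C) :
    Prop :=
  qexpansion h (fun x => (x == - m)%:R + c x) /\
  forall x, c x != 0 -> E x /\ ~ I (- x).

(* (f m)_(m in I) is a basis of V, and f m, whose expansion has the
   coefficients c m, is the unique element of V of the reduced form. *)
Definition canonical_basis (V : set (C -> C)) (E I : set rat)
    (f : rat -> C -> C) (c : rat -> rat -> C) : Prop :=
  [/\ forall m, I m -> V (f m) /\ reduced_form E I m (f m) (c m),
      forall m, I m -> forall h d,
        V h -> reduced_form E I m h d -> agree h (f m),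
      forall h, V h -> exists (s : seq rat) (l : rat -> C),
        (forall m, m \in s -> I m) /\
        agree h (fun z => \sum_(m <- s) l m * f m z) &
      forall (s : seq rat) (l : rat -> C),
        uniq s -> (forall m, m \in s -> I m) ->
        agree (fun z => \sum_(m <- s) l m * f m z) (fun=> 0) ->
        forall m, m \in s -> l m = 0].

End Groups.

(* Main.v *)
Require Import Defs.
From mathcomp Require Import all_boot all_order all_algebra.
From mathcomp Require Import complex ring lra zify.
From mathcomp Require Import boolp classical_sets functions cardinality reals.
From mathcomp Require Import topology normedtype sequences derive exp trigo.

Set Implicit Arguments.
Unset Strict Implicit.
Unset Printing Implicit Defensive.

Import Order.TTheory GRing.Theory Num.Theory.
Import numFieldNormedType.Exports.

Local Open Scope classical_set_scope.
Local Open Scope complex_scope.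
Local Open Scope ring_scope.

(** The product [F = f_m g_n] transforms like a weight 2 form with trivial
    multiplier, because nu has absolute value 1 and the automorphy factors of
    weights k and 2 - k multiply to [(cz + d)^2]. It is holomorphic on the upper
    half-plane, has a pole at most at the cusp infinity, and vanishes at all
    other cusps. By the residue theorem its constant term at infinity is zero.
    On the other hand Z^(nu) is the disjoint union of [- I] and [J]
    ([index_sets_cover], [index_sets_disjoint]), so that in the constant term
    [\sum_x A(x) B(- x)] of the product of the two reduced expansions only
    [x = - m] and [x = n] contribute, and what they contribute is
    [b(n, m) + a(m, n)].

    The residue theorem ([constant_term_weight2]) is proved without contours, by
    means of primitives on the upper half-plane.
    - A product of two q-expansions has a primitive P, obtained by integrating
      the double series termwise; P is the sum of [c z], with c the constant
      term, and of a periodic function ([qexpansion_mul_primitive]).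
    - Since F has weight 2, [P (g z) - P z] has derivative zero, hence is
      constant, for every g in G.
    - Let H be the intersection of G and SL2(Z). The sum Phi of the functions
      [P (r^-1 z)], with r running over representatives of the cosets r H in
      SL2(Z), changes by a constant under every element of SL2(Z), and these
      constants vanish: the inversion [z |-> - 1 / z] fixes i, and it sends
      rho = exp(i pi / 3) to rho - 1. So Phi has period 1
      ([periodic_of_cocycle]).
    - Under large translations, the summand of r changes by c times a positive
      number if [r^-1] maps infinity to a cusp equivalent to infinity, and does
      not change otherwise, since F vanishes at that cusp. The coset H is of the
      first kind, so c = 0. *)

(** * The real-valued modulus and complex derivatives *)

Section ComplexNorm.
Variable R : realType.
Local Notation C := R[i].
Local Notation normc := (@Normc.normc R).
Implicit Types (x y z : C).

Lemma normC_normc x : `|x| = (normc x)%:C.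
Proof. by case: x => a b; rewrite normc_def. Qed.

Lemma normc_ge0 x : 0 <= normc x.
Proof. by case: x => a b; rewrite sqrtr_ge0. Qed.

Lemma normc_triangle x y : normc (x + y) <= normc x + normc y.
Proof. exact: (@le_normcD R x y). Qed.

Lemma normc_sum (I : Type) (r : seq I) (P : pred I) (F : I -> C) :
  normc (\sum_(i <- r | P i) F i) <= \sum_(i <- r | P i) normc (F i).
Proof.
elim/big_ind2 : _ => [|x u y v xu yv|//]; first by rewrite Normc.normc0.
exact: le_trans (normc_triangle _ _) (lerD xu yv).
Qed.

Lemma normc_opp x : normc (- x) = normc x.
Proof. by case: x => a b /=; rewrite !sqrrN. Qed.

Lemma normc_distC x y : normc (x - y) = normc (y - x).
Proof. by rewrite -normc_opp opprB. Qed.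

Lemma normc_real (a : R) : normc a%:C = `|a|.
Proof. by rewrite /= expr0n addr0 sqrtr_sqr. Qed.

Lemma normcX x (n : nat) : normc (x ^+ n) = normc x ^+ n.
Proof.
elim: n => [|n IH]; first by rewrite !expr0 Normc.normc1.
by rewrite !exprS Normc.normcM IH.
Qed.

Lemma normc_eq0 x : (normc x == 0) = (x == 0).
Proof.
by apply/eqP/eqP => [/Normc.eq0_normc//|->]; rewrite Normc.normc0.
Qed.

Lemma normc_gt0 x : (0 < normc x) = (x != 0).
Proof. by rewrite lt_neqAle normc_ge0 andbT eq_sym normc_eq0. Qed.

Lemma Re_le_normc x : `|complex.Re x| <= normc x.
Proof. by have := normc_ge_Re x; rewrite normC_normc lecR. Qed.

Lemma Im_le_normc x : `|complex.Im x| <= normc x.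
Proof.
case: x => a b /=; rewrite -sqrtr_sqr ler_wsqrtr// lerDr; exact: sqr_ge0.
Qed.

Lemma normc_le_ReIm x : normc x <= `|complex.Re x| + `|complex.Im x|.
Proof.
case: x => a b; rewrite [X in normc X]complexE.
apply: le_trans (normc_triangle _ _) _.
rewrite Normc.normcM !normc_real /= lerD2l.
by rewrite expr0n expr1n add0r sqrtr1 mul1r.
Qed.

Lemma cReD x y : complex.Re (x + y) = complex.Re x + complex.Re y.
Proof. by case: x y => [a b] [c d]. Qed.
Lemma cImD x y : complex.Im (x + y) = complex.Im x + complex.Im y.
Proof. by case: x y => [a b] [c d]. Qed.
Lemma cReN x : complex.Re (- x) = - complex.Re x.
Proof. by case: x. Qed.
Lemma cImN x : complex.Im (- x) = - complex.Im x.
Proof. by case: x. Qed.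
Lemma cReM x y : complex.Re (x * y) =
  complex.Re x * complex.Re y - complex.Im x * complex.Im y.
Proof. by case: x y => [a b] [c d]. Qed.
Lemma cImM x y : complex.Im (x * y) =
  complex.Re x * complex.Im y + complex.Im x * complex.Re y.
Proof. by case: x y => [a b] [c d] /=; rewrite addrC. Qed.

End ComplexNorm.

Section Derivatives.
Variable R : realType.
Local Notation C := R[i].
Local Notation normc := (@Normc.normc R).
Implicit Types (f g : C -> C) (z w l : C).

(** This is the interface with the real mean value theorem and with the known
    derivatives of exp, sin and cos. *)
Lemma is_derive1_epsP (f : R -> R) (x l : R) :
  (forall e : R, 0 < e -> exists2 d : R, 0 < d & forall h, `|h| < d ->
     `|f (x + h) - f x - l * h| <= e * `|h|) <-> is_derive x 1 f l.
Proof.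
have E h : h != 0 -> `|l - h^-1 *: ((f \o shift x) (h *: 1) - f x)| =
    `|f (x + h) - f x - l * h| / `|h|.
  move=> h0; rewrite /= /shift /= [h *: 1]mulr1 [h + x]addrC.
  rewrite (_ : h^-1 *: _ = h^-1 * (f (x + h) - f x))// -normfV -normrM -normrN.
  by congr (`| _ |); field.
split=> [H|[fx fE] e e0].
  have L : (h^-1 *: ((f \o shift x) (h *: 1) - f x)) @[h --> 0^'] --> l.
    apply/cvgrPdist_le => e /H[d d0 {}H].
    near=> h.
    have h0 : h != 0 by near: h; exact: nbhs_dnbhs_neq.
    rewrite E// ler_pdivrMr ?normr_gt0// H//.
    near: h; exact: dnbhs0_lt.
  apply: DeriveDef; first by apply/cvg_ex; exists l.
  exact/cvg_lim.
have L : (h^-1 *: ((f \o shift x) (h *: 1) - f x)) @[h --> 0^'] --> l.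
  by rewrite -fE; exact: fx.
move/cvgrPdist_le : L => /(_ e e0).
rewrite /dnbhs /within /= => -[d d0 H]; exists d => // h hd.
have [->|h0] := eqVneq h 0; first by rewrite addr0 mulr0 !subrr normr0 mulr0.
have := H h; rewrite /= sub0r normrN => /(_ hd h0).
by rewrite E// ler_pdivrMr ?normr_gt0.
Unshelve. all: by end_near. Qed.

(** The complex derivative, stated with the real-valued modulus so that all the
    estimates below compare real numbers. *)
Definition has_deriv f z l := forall e : R, 0 < e ->
  exists2 d : R, 0 < d &
    forall h, normc h < d -> normc (f (z + h) - f z - l * h) <= e * normc h.

Lemma has_deriv_affine (a b : C) z : has_deriv (fun w => a * w + b) z a.
Proof.
move=> e e0; exists 1 => // h _.
have -> : a * (z + h) + b - (a * z + b) - a * h = 0 by ring.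
by rewrite Normc.normc0; exact: mulr_ge0 (ltW e0) (normc_ge0 h).
Qed.

Lemma has_derivD f g z l m : has_deriv f z l -> has_deriv g z m ->
  has_deriv (fun w => f w + g w) z (l + m).
Proof.
move=> Hf Hg e e0; have e20 : 0 < e / 2 by rewrite divr_gt0.
have [d d0 {}Hf] := Hf _ e20; have [d' d'0 {}Hg] := Hg _ e20.
exists (Num.min d d'); first by rewrite lt_min d0.
move=> h; rewrite lt_min => /andP[/Hf{}Hf /Hg{}Hg].
have -> : f (z + h) + g (z + h) - (f z + g z) - (l + m) * h =
  (f (z + h) - f z - l * h) + (g (z + h) - g z - m * h) by ring.
apply: le_trans (normc_triangle _ _) _; lra.
Qed.

Lemma has_deriv_comp f g z l m : has_deriv f z l -> has_deriv g (f z) m ->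
  has_deriv (fun w => g (f w)) z (m * l).
Proof.
move=> Hf Hg e e0.
pose A : R := 1 + normc l; have A0 : 0 < A by rewrite ltr_wpDr ?normc_ge0.
pose B : R := 1 + normc m; have B0 : 0 < B by rewrite ltr_wpDr ?normc_ge0.
have [d d0 {}Hg] := Hg (e / 2 / A) (divr_gt0 (divr_gt0 e0 (ltr0Sn R 1)) A0).
have [d1 d10 Hf1] := Hf (e / 2 / B) (divr_gt0 (divr_gt0 e0 (ltr0Sn R 1)) B0).
have [d2 d20 Hf2] := Hf 1 ltr01.
exists (Num.min (d / A) (Num.min d1 d2)).
  by rewrite !lt_min divr_gt0// d10.
move=> h; rewrite !lt_min => /and3P[hd /Hf1{}Hf1 /Hf2{}Hf2].
pose k := f (z + h) - f z.
have kA : normc k <= A * normc h.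
  have -> : k = (f (z + h) - f z - l * h) + l * h by rewrite /k; ring.
  apply: le_trans (normc_triangle _ _) _.
  by rewrite Normc.normcM /A mulrDl lerD2r.
have kd : normc k < d.
  by apply: le_lt_trans kA _; rewrite mulrC -ltr_pdivlMr.
have {Hg} := Hg _ kd.
have -> : f z + k = f (z + h) by rewrite /k; ring.
move=> Hg.
have -> : g (f (z + h)) - g (f z) - m * l * h =
  (g (f (z + h)) - g (f z) - m * k) + m * (f (z + h) - f z - l * h).
  by rewrite /k; ring.
apply: le_trans (normc_triangle _ _) _.
have -> : e * normc h = e / 2 * normc h + e / 2 * normc h by field.
apply: lerD.
  apply: le_trans Hg _.
  rewrite -[e / 2 / A * _]mulrA ler_wpM2l//; last by rewrite ler_pdivrMl.
  exact: ltW (divr_gt0 e0 (ltr0Sn R 1)).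
rewrite Normc.normcM (_ : e / 2 * normc h = B * (e / 2 / B * normc h)).
  by apply: ler_pM; rewrite ?normc_ge0// /B lerDr.
by field; rewrite gt_eqF.
Qed.

Lemma has_derivZ c f z l : has_deriv f z l -> has_deriv (fun w => c * f w) z (c * l).
Proof.
move=> Hf.
have := has_deriv_comp Hf (has_deriv_affine c 0 (f z)).
by under eq_fun do rewrite addr0.
Qed.

Lemma has_derivB f g z l m : has_deriv f z l -> has_deriv g z m ->
  has_deriv (fun w => f w - g w) z (l - m).
Proof.
move=> Hf /(has_derivZ (-1)) Hg.
have := has_derivD Hf Hg.
by rewrite mulN1r; under eq_fun do rewrite mulN1r.
Qed.

Lemma has_deriv_sum (I : Type) (r : seq I) (F : I -> C -> C) (L : I -> C) z :
  (forall i, has_deriv (F i) z (L i)) ->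
  has_deriv (fun w => \sum_(i <- r) F i w) z (\sum_(i <- r) L i).
Proof.
move=> H; elim: r => [|i r IH].
  rewrite big_nil (_ : (fun w => _) = fun w => 0 * w + 0).
    exact: has_deriv_affine.
  by apply/funext => w; rewrite big_nil mul0r addr0.
rewrite big_cons (_ : (fun w => _) = fun w => F i w + \sum_(j <- r) F j w).
  exact: has_derivD.
by apply/funext => w; rewrite big_cons.
Qed.

Lemma has_deriv_inv z : z != 0 -> has_deriv (fun w => w^-1) z (- (z ^- 2)).
Proof.
rewrite -normc_gt0 => z0 e e0.
exists (Num.min (normc z / 2) (e * normc z ^+ 3 / 2)).
  by rewrite lt_min !divr_gt0// mulr_gt0// exprn_gt0.
move=> h; rewrite lt_min => /andP[h1 h2].
have zh : normc z / 2 <= normc (z + h).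
  have := normc_triangle (z + h) (- h); rewrite normc_opp addrK; lra.
have zh0 : 0 < normc (z + h) by apply: lt_le_trans zh; rewrite divr_gt0.
have -> : (z + h)^-1 - z^-1 - - z ^- 2 * h = h ^+ 2 / (z ^+ 2 * (z + h)).
  by field; rewrite -!normc_gt0 zh0.
rewrite !(Normc.normcM, Normc.normcV, normcX).
rewrite ler_pdivrMr ?mulr_gt0 ?exprn_gt0//.
rewrite expr2 [e * _]mulrC -[normc h * e * _]mulrA.
apply: ler_wpM2l; first exact: normc_ge0.
apply: le_trans (ltW h2) _.
rewrite (_ : e * _ / 2 = e * (normc z ^+ 2 * (normc z / 2))); last by field.
apply: ler_wpM2l; first exact: ltW.
by apply: ler_wpM2l => //; exact: exprn_ge0 (ltW z0).
Qed.

(** A Moebius transformation has its familiar expressions only away from the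
    pole, so equality is asked on the upper half-plane alone. *)
Lemma has_deriv_eq_uhp f g z l : uhp z -> (forall w, uhp w -> f w = g w) ->
  has_deriv f z l -> has_deriv g z l.
Proof.
move=> z0 fg Hf e /Hf[d d0 {}Hf]; exists (Num.min d (complex.Im z)).
  by rewrite lt_min d0.
move=> h; rewrite lt_min => /andP[hd hz]; rewrite -!fg ?Hf//.
have := le_lt_trans (Im_le_normc h) hz.
by rewrite ltr_norml /uhp/= cImD => /andP[+ _]; lra.
Qed.

(** The real mean value theorem on the segment from z to w bounds the real and
    the imaginary part of [f w - f z] separately, whence the factor 2; the strip
    is convex, so it contains the segment. *)
Lemma mean_value_strip f (F : C -> C) (y0 y1 e : R) :
  (forall z, y0 < complex.Im z < y1 -> has_deriv f z (F z)) ->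
  (forall z, y0 < complex.Im z < y1 -> normc (F z) <= e) ->
  forall z w, y0 < complex.Im z < y1 -> y0 < complex.Im w < y1 ->
  normc (f w - f z) <= 2 * e * normc (w - z).
Proof.
move=> Hf He z w /andP[z0 z1] /andP[w0 w1].
pose p (t : R) : C := z + t%:C * (w - z).
have pS (t : R) : t \in `[0, 1] -> y0 < complex.Im (p t) < y1.
  rewrite in_itv/= => /andP[t0 t1].
  rewrite /p cImD cImM/= mul0r addr0 cImD cImN.
  by have [zw|zw] := lerP (complex.Im z) (complex.Im w); apply/andP; split; nra.
have p0 : p 0 = z by rewrite /p rmorph0 mul0r addr0.
have p1 : p 1 = w by rewrite /p rmorph1 mul1r; ring.
have bound (T : C -> R) : (forall x, `|T x| <= normc x) ->
    (forall x y, T (x - y) = T x - T y) ->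
    (forall (a : R) x, T (a%:C * x) = a * T x) ->
    `|T (f w - f z)| <= e * normc (w - z).
  move=> Tn TB TZ.
  have D (t : R) : t \in `[0, 1] ->
      is_derive t 1 (fun s => T (f (p s))) (T (F (p t) * (w - z))).
    move=> t01; have Ht : has_deriv f (p t) (F (p t)) by exact/Hf/pS.
    apply/is_derive1_epsP => e' e'0.
    have N0 : 0 < 1 + normc (w - z) by rewrite ltr_wpDr ?normc_ge0.
    have [d d0 {}Ht] := Ht _ (divr_gt0 e'0 N0).
    exists (d / (1 + normc (w - z))); first exact: divr_gt0.
    move=> h; rewrite ltr_pdivlMr// => hd.
    have hN : normc (h%:C * (w - z)) <= `|h| * (1 + normc (w - z)).
      by rewrite Normc.normcM normc_real ler_wpM2l// lerDr.
    have := Ht _ (le_lt_trans hN hd).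
    have -> : p t + h%:C * (w - z) = p (t + h) by rewrite /p rmorphD/=; ring.
    rewrite [T _ * h]mulrC -TZ -!TB => {}Ht.
    apply: le_trans (Tn _) _.
    have -> : h%:C * (F (p t) * (w - z)) = F (p t) * (h%:C * (w - z)) by ring.
    apply: le_trans Ht _.
    apply: le_trans (ler_wpM2l (ltW (divr_gt0 e'0 N0)) hN) _.
    by rewrite mulrCA mulrC divfK ?gt_eqF// mulrC.
  have Doo (t : R) (t01 : t \in `]0, 1[) := D t (subset_itv_oo_cc t01).
  have cont : {within `[0, 1], continuous (fun s => T (f (p s)))}.
    by apply: derivable_within_continuous => t t01; have [] := D t t01.
  have [c c01] := MVT_segment ler01 Doo cont.
  rewrite p0 p1 subr0 mulr1 TB => ->.
  apply: le_trans (Tn _) _; rewrite Normc.normcM ler_wpM2r ?normc_ge0//.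
  exact/He/pS.
apply: le_trans (normc_le_ReIm _) _.
have -> : 2 * e * normc (w - z) = e * normc (w - z) + e * normc (w - z) by ring.
apply: lerD; apply: bound.
- exact: Re_le_normc.
- by move=> x y; rewrite cReD cReN.
- by move=> a x; rewrite cReM/= mul0r subr0.
- exact: Im_le_normc.
- by move=> x y; rewrite cImD cImN.
- by move=> a x; rewrite cImM/= mul0r addr0.
Qed.

End Derivatives.

(** * The exponential functions q^r *)

Section Exponentials.
Variable R : realType.
Local Notation C := R[i].
Local Notation normc := (@Normc.normc R).
Implicit Types (f g : C -> C) (z w l : C) (r s : rat).

(** Any two points lie in a common strip of the half-plane, where the mean value
    inequality applies with bound 0. *)
Lemma zero_deriv_const f : (forall z, uhp z -> has_deriv f z 0) ->
  forall z w, uhp z -> uhp w -> f z = f w.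
Proof.
move=> Hf z w z0 w0; apply/eqP; rewrite eq_sym -subr_eq0 -normc_eq0.
rewrite eq_le normc_ge0 andbT.
have y1 : 0 < complex.Im z < complex.Im z + complex.Im w + 1.
  by move: z0 w0; rewrite /uhp/= => -> ? /=; lra.
have y2 : 0 < complex.Im w < complex.Im z + complex.Im w + 1.
  by move: z0 w0; rewrite /uhp/= => ? -> /=; lra.
have := mean_value_strip (y1 := complex.Im z + complex.Im w + 1)
  (fun z zS => Hf z (proj1 (andP zS))) _ y1 y2 (e := 0).
by rewrite mulr0 mul0r; apply=> *; rewrite Normc.normc0.
Qed.

Definition cexp z : C :=
  (expR (complex.Re z))%:C * (cos (complex.Im z) +i* sin (complex.Im z)).

Lemma cexpD z w : cexp (z + w) = cexp z * cexp w.
Proof.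
case: z w => [a b] [c d]; rewrite /cexp /= expRD cosD sinD.
by apply/eqP; rewrite eq_complex /=; apply/andP; split; apply/eqP; ring.
Qed.

Lemma cexp0 : cexp 0 = 1.
Proof. by rewrite /cexp /= expR0 cos0 sin0 mul1r. Qed.

Lemma normc_cexp z : normc (cexp z) = expR (complex.Re z).
Proof.
rewrite Normc.normcM normc_real ger0_norm ?expR_ge0//=.
by rewrite cos2Dsin2 sqrtr1 mulr1.
Qed.

(** [exp (a + ib) - 1 - (a + ib)] splits into remainders of the first order
    expansions of exp, sin and cos at 0, each of which is known to be small. *)
Lemma has_deriv_cexp0 : has_deriv cexp 0 1.
Proof.
move=> e e0.
pose u : R := Num.min (e / 8) 1.
have u0 : 0 < u by rewrite lt_min ltr01 divr_gt0.
have u1 : u <= 1 by rewrite ge_min lexx orbT.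
have ue : u <= e / 8 by rewrite ge_min lexx.
clearbody u.
have [d1 d10 H1] : exists2 d : R, 0 < d & forall h, `|h| < d ->
    `|expR h - 1 - h| <= u * `|h|.
  have [d d0 H] := (is_derive1_epsP _ _ _).2 (is_derive_expR 0) u u0.
  by exists d => // h /H; rewrite add0r expR0 mul1r.
have [d2 d20 H2] : exists2 d : R, 0 < d & forall h, `|h| < d ->
    `|sin h - h| <= u * `|h|.
  have [d d0 H] := (is_derive1_epsP _ _ _).2 (is_derive_sin 0) u u0.
  by exists d => // h /H; rewrite add0r sin0 cos0 subr0 mul1r.
have [d3 d30 H3] : exists2 d : R, 0 < d & forall h, `|h| < d ->
    `|cos h - 1| <= u * `|h|.
  have [d d0 H] := (is_derive1_epsP _ _ _).2 (is_derive_cos 0) u u0.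
  by exists d => // h /H; rewrite add0r sin0 cos0 oppr0 mul0r subr0.
exists (Num.min (Num.min d1 (u / 2)) (Num.min d2 d3)).
  by rewrite !lt_min d10 d20 d30 divr_gt0.
move=> h; rewrite !lt_min => /andP[/andP[hd1 hd] /andP[hd2 hd3]].
have ha := Re_le_normc h; have hb := Im_le_normc h.
apply: le_trans (normc_le_ReIm _) _.
case: h ha hb hd1 hd2 hd3 hd => a b /=; set n := Num.sqrt _ => ha hb hd1 hd2 hd3 hd.
have {}H1 := H1 a (le_lt_trans ha hd1).
have {}H2 := H2 b (le_lt_trans hb hd2).
have {}H3 := H3 b (le_lt_trans hb hd3).
rewrite !add0r expR0 cos0 sin0 !(mul1r, mul0r, mulr0, subr0, addr0, oppr0).
have n0 : 0 <= n by exact: sqrtr_ge0.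
have un : u * n <= e / 8 * n by rewrite ler_wpM2r.
have ua : u * `|a| <= u * n by rewrite ler_wpM2l// ltW.
have ub : u * `|b| <= u * n by rewrite ler_wpM2l// ltW.
have un1 : u * n <= n by rewrite ler_piMl.
have E1 : `|expR a| <= 2.
  have -> : expR a = (expR a - 1 - a) + a + 1 by ring.
  apply: le_trans (ler_normD _ _) _; rewrite normr1.
  have := ler_normD (expR a - 1 - a) a; lra.
have E2 : `|expR a - 1| <= u.
  have -> : expR a - 1 = (expR a - 1 - a) + a by ring.
  have := ler_normD (expR a - 1 - a) a; lra.
have -> : expR a * cos b - 1 - a = (expR a - 1 - a) + expR a * (cos b - 1) by ring.
have -> : expR a * sin b - b = expR a * (sin b - b) + (expR a - 1) * b by ring.
apply: le_trans (lerD (ler_normD _ _) (ler_normD _ _)) _.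
rewrite !normrM.
have F1 : `|expR a| * `|cos b - 1| <= 2 * (u * `|b|) by exact: ler_pM.
have F2 : `|expR a| * `|sin b - b| <= 2 * (u * `|b|) by exact: ler_pM.
have F3 : `|expR a - 1| * `|b| <= u * `|b| by exact: ler_pM.
have un0 : 0 <= u * n by rewrite mulr_ge0// ltW.
lra.
Qed.

Lemma has_deriv_cexp z : has_deriv cexp z (cexp z).
Proof.
have -> : cexp = fun w => cexp z * cexp (1 * w + - z).
  by apply/funext => w; rewrite -cexpD; congr cexp; ring.
rewrite -cexpD mul1r subrr addr0.
have H : has_deriv (fun w => cexp (1 * w + - z)) z (1 * 1).
  apply: has_deriv_comp (has_deriv_affine 1 (- z) z) _.
  rewrite mul1r subrr; exact: has_deriv_cexp0.
by have := has_derivZ (cexp z) H; rewrite !mulr1.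
Qed.

(** [q^r = cexp (freq r * z)], so [freq r] is 2 pi i r. *)
Definition freq r : C := 0 +i* (2 * pi * ratr r).

Lemma qpow_cexp r z : qpow r z = cexp (freq r * z).
Proof.
case: z => a b; rewrite /qpow /cexp /freq /=.
by rewrite !mul0r sub0r add0r.
Qed.

Lemma freqD r s : freq (r + s) = freq r + freq s.
Proof.
rewrite /freq rmorphD/= mulrDr; apply/eqP.
by rewrite eq_complex/= addr0 !eqxx.
Qed.

Lemma freq_eq0 r : (freq r == 0) = (r == 0).
Proof.
rewrite eq_complex /= eqxx /= mulf_eq0 fmorph_eq0 -[_ * pi == 0]negbK.
by rewrite mulf_neq0 ?pnatr_eq0// gt_eqF// pi_gt0.
Qed.

Lemma qpowD r s z : qpow (r + s) z = qpow r z * qpow s z.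
Proof. by rewrite !qpow_cexp freqD mulrDl cexpD. Qed.

Lemma qpow_addz r z w : qpow r (z + w) = qpow r z * qpow r w.
Proof. by rewrite !qpow_cexp mulrDr cexpD. Qed.

Lemma qpow0 z : qpow 0 z = 1.
Proof. by rewrite qpow_cexp (eqP (_ : freq 0 == 0)) ?freq_eq0// mul0r cexp0. Qed.

Lemma normc_qpow r z :
  normc (qpow r z) = expR (- (2 * pi * ratr r * complex.Im z)).
Proof. by rewrite qpow_cexp normc_cexp; case: z => a b /=; rewrite mul0r sub0r. Qed.

Lemma has_deriv_qpow r z : has_deriv (qpow r) z (freq r * qpow r z).
Proof.
have -> : qpow r = fun w => cexp (freq r * w + 0).
  by apply/funext => w; rewrite qpow_cexp addr0.
rewrite mulrC; exact: has_deriv_comp (has_deriv_affine _ _ _) (has_deriv_cexp _).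
Qed.

Lemma qpow_nat_period r (k : nat) (n : int) z :
  r * k%:R = n%:~R -> qpow r (z + k%:R) = qpow r z.
Proof.
move=> rk; rewrite qpow_addz.
suff -> : qpow r (k%:R : C) = 1 by rewrite mulr1.
rewrite qpow_cexp; have -> : freq r * k%:R = freq (r * k%:R).
  rewrite -(rmorph_nat (real_complex R)) /freq /= rmorphM/= ratr_nat.
  by apply/eqP; rewrite eq_complex/=; apply/andP; split; apply/eqP; ring.
rewrite {}rk.
have nat1 (m : nat) : cexp (freq m%:R) = 1.
  elim: m => [|m IH]; first by rewrite (eqP (_ : freq 0 == 0)) ?freq_eq0// cexp0.
  rewrite mulrS freqD cexpD IH mulr1 /cexp /freq /= rmorph1 expR0 mul1r mulr1.
  by rewrite mulr_natl cos2pi sin2pi.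
case: n => m; first by rewrite -pmulrn.
rewrite NegzE mulrNz -pmulrn -[LHS]mulr1 -(nat1 m.+1) -cexpD -freqD addNr.
by rewrite (eqP (_ : freq 0 == 0)) ?freq_eq0// cexp0.
Qed.

End Exponentials.

(** * Limits of primitives *)

Section Limits.
Variable R : realType.
Local Notation C := R[i].
Local Notation normc := (@Normc.normc R).
Implicit Types (u v : nat -> C) (l m c : C).

Definition tends u l := forall e : R, 0 < e ->
  exists n0, forall n, (n0 <= n)%N -> normc (u n - l) <= e.

Lemma tendsP u l : ((u : nat -> C^o) @ \oo --> (l : C^o)) -> tends u l.
Proof.
move=> /cvgrPdist_le H e e0.
have e0C : 0 < e%:C :> C by rewrite ltcR.
have [n0 _ {}H] := H _ e0C; exists n0 => n /H.
by rewrite /= (normC_normc (l - u n)) lecR normc_distC.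
Qed.

Lemma tendsB u v l m : tends u l -> tends v m ->
  tends (fun n => u n - v n) (l - m).
Proof.
move=> Hu Hv e e0; have e20 : 0 < e / 2 by rewrite divr_gt0.
have [n1 {}Hu] := Hu _ e20; have [n2 {}Hv] := Hv _ e20.
exists (maxn n1 n2) => n; rewrite geq_max => /andP[/Hu{}Hu /Hv{}Hv].
have -> : u n - v n - (l - m) = (u n - l) - (v n - m) by ring.
apply: le_trans (normc_triangle _ _) _; rewrite normc_opp; lra.
Qed.

Lemma tends_le u l c (b : R) n0 : tends u l ->
  (forall n, (n0 <= n)%N -> normc (u n - c) <= b) -> normc (l - c) <= b.
Proof.
move=> Hu Hb; apply/ler_addgt0Pr => e /Hu [n1 {}Hu].
pose n := maxn n0 n1.
have := Hu n (leq_maxr _ _); have := Hb n (leq_maxl _ _).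
have -> : l - c = (u n - c) - (u n - l) by ring.
move=> H1 H2; apply: le_trans (normc_triangle _ _) _; rewrite normc_opp; lra.
Qed.

Lemma tends_eventually_const u l c n0 : tends u l ->
  (forall n, (n0 <= n)%N -> u n = c) -> l = c.
Proof.
move=> Hu Hc; apply/eqP; rewrite -subr_eq0 -normc_eq0 eq_le normc_ge0 andbT.
by apply: (tends_le Hu) => n /Hc ->; rewrite subrr Normc.normc0.
Qed.

(** Completeness of the complex numbers, read off from that of the reals on the
    real and imaginary parts. *)
Lemma cauchy_tends u :
  (forall e : R, 0 < e -> exists n0, forall n m : nat, (n0 <= n)%N -> (n0 <= m)%N ->
     normc (u n - u m) <= e) ->
  exists l, tends u l.
Proof.
move=> H.
have part (T : C -> R) : (forall x, `|T x| <= normc x) ->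
    (forall x y, T (x - y) = T x - T y) ->
    exists l : R, forall e, 0 < e ->
      exists n0, forall n, (n0 <= n)%N -> `|T (u n) - l| <= e.
  move=> Tn TB.
  have : cvg ((fun n => T (u n)) @ \oo).
    apply/cauchy_cvgP/cauchy_ballP => e e0.
    have e20 : 0 < e / 2 by rewrite divr_gt0.
    have [n0 {}H] := H _ e20.
    pose I := [set x : R | exists2 n, (n0 <= n)%N & x = T (u n)].
    exists (I, I) => /=.
      by split; exists n0 => // n nn0; exists n.
    move=> _ [[n n1 ->] [m m1 ->]]; rewrite /ball/= -TB.
    apply: le_lt_trans (Tn _) _; apply: le_lt_trans (H _ _ n1 m1) _; lra.
  move=> /cvg_ex[l /cvgrPdist_le L]; exists l => e /L[n0 _ {}L].
  by exists n0 => n /L; rewrite distrC.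
have [a Ha] := part _ (@Re_le_normc R)
  (fun x y => etrans (cReD _ _) (congr1 _ (cReN _))).
have [b Hb] := part _ (@Im_le_normc R)
  (fun x y => etrans (cImD _ _) (congr1 _ (cImN _))).
exists (a +i* b) => e e0; have e20 : 0 < e / 2 by rewrite divr_gt0.
have [n1 {}Ha] := Ha _ e20; have [n2 {}Hb] := Hb _ e20.
exists (maxn n1 n2) => n; rewrite geq_max => /andP[/Ha{}Ha /Hb{}Hb].
apply: le_trans (normc_le_ReIm _) _.
by rewrite cReD cReN cImD cImN /=; lra.
Qed.

Lemma geometric_tail (rho : R) (m n : nat) : 0 <= rho < 1 -> (m <= n)%N ->
  \sum_(m <= i < n) rho ^+ i <= rho ^+ m / (1 - rho).
Proof.
move=> /andP[r0 r1] mn.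
have r10 : 0 < 1 - rho by rewrite subr_gt0.
rewrite ler_pdivlMr//.
have -> : (\sum_(m <= i < n) rho ^+ i) * (1 - rho) = rho ^+ m - rho ^+ n.
  rewrite mulr_suml -[RHS]opprB -telescope_sumr// -sumrN.
  by apply: eq_bigr => i _; rewrite exprS; ring.
by rewrite lerBlDr lerDl exprn_ge0.
Qed.

Lemma geometric_small (K rho e : R) : 0 <= rho < 1 -> 0 < e -> 0 <= K ->
  exists n0, forall n, (n0 <= n)%N -> K * rho ^+ n <= e.
Proof.
move=> /andP[r0 r1] e0 K0.
have : (geometric K rho) @ \oo --> (0 : R).
  by apply: cvg_geometric; rewrite ger0_norm.
move=> /cvgrPdist_le /(_ _ e0) [n0 _ H]; exists n0 => n /H.
by rewrite /= sub0r normrN ger0_norm// mulr_ge0// exprn_ge0.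
Qed.

End Limits.

Section Primitives.
Variable R : realType.
Local Notation C := R[i].
Local Notation normc := (@Normc.normc R).

(** Uniform convergence on horizontal strips bounded away from the real axis.
    Strips are convex, as the mean value inequality requires, and every point
    of the half-plane is interior to one. *)
Definition strip_cvg (Fn : nat -> C -> C) (F : C -> C) :=
  forall y0 y1 e : R, 0 < y0 -> 0 < e -> exists n0, forall n, (n0 <= n)%N ->
    forall z, y0 < complex.Im z < y1 -> normc (F z - Fn n z) <= e.

(** If the derivatives [Fn n] converge uniformly on strips, then the mean value
    inequality makes the increments of the [Qn n] uniformly Cauchy relative to
    the length of the increment. So the increments converge, and the limit Q,
    normalised to vanish at i, has the limit of the derivatives as derivative.
    The last clause transports to Q every increment that is eventually constant
    along the sequence. *)
Lemma primitive_limit (Fn Qn : nat -> C -> C) (F : C -> C) :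
  (forall n z, uhp z -> has_deriv (Qn n) z (Fn n z)) -> strip_cvg Fn F ->
  exists Q, (forall z, uhp z -> has_deriv Q z (F z)) /\
    forall z w c n0, uhp z -> uhp w ->
      (forall n, (n0 <= n)%N -> Qn n w - Qn n z = c) -> Q w - Q z = c.
Proof.
move=> QF FnF.
have key (y0 y1 e : R) : 0 < y0 -> 0 < e -> exists n0, forall n m,
    (n0 <= n)%N -> (n0 <= m)%N -> forall z w,
    y0 < complex.Im z < y1 -> y0 < complex.Im w < y1 ->
    normc ((Qn n w - Qn n z) - (Qn m w - Qn m z)) <= e * normc (w - z).
  move=> y00 e0; have e40 : 0 < e / 4 by rewrite divr_gt0.
  have [n0 H] := FnF y0 y1 _ y00 e40; exists n0 => n m nn0 mn0 z w zS wS.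
  have -> : Qn n w - Qn n z - (Qn m w - Qn m z) =
    (Qn n w - Qn m w) - (Qn n z - Qn m z) by ring.
  have -> : e = 2 * (e / 2) by field.
  apply: (@mean_value_strip R (fun z => Qn n z - Qn m z)
    (fun z => Fn n z - Fn m z) y0 y1) => // x xS.
    have x0 : uhp x by rewrite /uhp/=; case/andP: xS => /(lt_trans y00).
    by apply: has_derivB; apply: QF.
  have -> : Fn n x - Fn m x = (F x - Fn m x) - (F x - Fn n x) by ring.
  apply: le_trans (normc_triangle _ _) _; rewrite normc_opp.
  have := H _ nn0 _ xS; have := H _ mn0 _ xS; lra.
have i0 : uhp ('i%C : C) by rewrite /uhp/=.
have [Q HQ] : exists Q : C -> C, forall z, uhp z ->
    tends (fun n => Qn n z - Qn n 'i%C) (Q z).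
  suff : forall z, exists l, uhp z -> tends (fun n => Qn n z - Qn n 'i%C) l.
    by move=> /choice[Q HQ]; exists Q.
  move=> z; have [z0|?] := pselect (uhp z); last by exists 0.
  suff [l Hl] : exists l, tends (fun n => Qn n z - Qn n 'i%C) l by exists l.
  apply: cauchy_tends => e e0.
  pose y0 : R := Num.min (complex.Im z) 1 / 2.
  have y00 : 0 < y0 by rewrite divr_gt0// lt_min ltr01 andbT.
  have yz : y0 < complex.Im z.
    rewrite ltr_pdivrMr// gt_min; apply/orP; left.
    by rewrite ltr_pMr// ltr1n.
  have y1 : y0 < 1.
    rewrite ltr_pdivrMr// gt_min; apply/orP; right.
    by rewrite mul1r ltr1n.
  have N0 : 0 < 1 + normc (z - 'i%C) by rewrite ltr_wpDr ?normc_ge0.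
  have [n0 H] := key y0 (complex.Im z + 2) _ y00 (divr_gt0 e0 N0).
  exists n0 => n m nn0 mn0.
  apply: le_trans (H n m nn0 mn0 _ _ _ _) _.
  - by rewrite /= y1 /=; move: z0; rewrite /uhp/=; lra.
  - by rewrite yz /=; lra.
  rewrite mulrAC ler_pdivrMr// ler_wpM2l ?(ltW e0)// lerDr//.
have HQB z w : uhp z -> uhp w -> tends (fun n => Qn n w - Qn n z) (Q w - Q z).
  move=> z0 w0; have := tendsB (HQ _ w0) (HQ _ z0).
  rewrite (_ : (fun n => _ - _ - _) = fun n => Qn n w - Qn n z)//.
  by apply/funext => n; ring.
exists Q; split=> [z z0 e e0|z w c n0 z0 w0]; last first.
  exact: tends_eventually_const (HQB z w z0 w0).
have e30 : 0 < e / 3 by rewrite divr_gt0.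
have y00 : 0 < complex.Im z / 2 by rewrite divr_gt0.
have zS : complex.Im z / 2 < complex.Im z < 2 * complex.Im z.
  by move: z0; rewrite /uhp/=; lra.
have [n1 H1] := key _ (2 * complex.Im z) _ y00 e30.
have [n2 H2] := FnF _ (2 * complex.Im z) _ y00 e30.
pose n := maxn n1 n2.
have [d d0 Hd] := QF n z z0 _ e30.
exists (Num.min d (complex.Im z / 2)); first by rewrite lt_min d0.
move=> h; rewrite lt_min => /andP[/Hd{}Hd hz].
have hS : complex.Im z / 2 < complex.Im (z + h) < 2 * complex.Im z.
  have := le_lt_trans (Im_le_normc h) hz; rewrite ltr_norml cImD; lra.
have h0 : uhp (z + h) by rewrite /uhp/=; case/andP: hS => /(lt_trans y00).
have E1 : normc (Q (z + h) - Q z - (Qn n (z + h) - Qn n z)) <= e / 3 * normc h.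
  apply: (tends_le (HQB _ _ z0 h0)) => m n1m.
  have := H1 m n n1m (leq_maxl _ _) _ _ zS hS.
  by rewrite (_ : z + h - z = h); last ring.
have E2 := H2 n (leq_maxr _ _) _ zS.
have -> : Q (z + h) - Q z - F z * h =
   (Q (z + h) - Q z - (Qn n (z + h) - Qn n z)) +
   ((Qn n (z + h) - Qn n z - Fn n z * h) + (- (F z - Fn n z)) * h) by ring.
apply: le_trans (normc_triangle _ _) _.
apply: le_trans (lerD E1 (normc_triangle _ _)) _.
rewrite Normc.normcM normc_opp.
have := ler_wpM2r (normc_ge0 h) E2; lra.
Qed.

End Primitives.

(** * Primitives of products of q-expansions *)

Section Expansions.
Variable R : realType.
Local Notation C := R[i].
Local Notation normc := (@Normc.normc R).
Implicit Types (a A B : rat -> C) (u v f : C -> C) (z w : C).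

Definition expo (N : nat) (n0 : int) (i : nat) : rat := (n0 + i%:Z)%:~R / N%:R.

Definition psum a N n0 (n : nat) z : C :=
  \sum_(0 <= i < n) a (expo N n0 i) * qpow (expo N n0 i) z.

Lemma qexpansion_tends f a : qexpansion f a -> exists N n0,
  [/\ (0 < N)%N, forall y, a y != 0 -> exists i, y = expo N n0 i &
      forall z, uhp z -> tends (fun n => psum a N n0 n z) (f z)].
Proof.
by move=> [N [n0 [N0 supp H]]]; exists N, n0; split=> // z /H/tendsP.
Qed.

(** Convergence at the point [i y0 / 2] bounds the terms there; moving up into
    the strip multiplies the i-th term by at most a constant times [rho ^+ i].
    The upper bound [y1] of the strip serves to control the finitely many terms
    with negative exponents. *)
Lemma psum_geometric f a N n0 (y0 y1 : R) : (0 < N)%N -> 0 < y0 ->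
  (forall z, uhp z -> tends (fun n => psum a N n0 n z) (f z)) ->
  exists K rho : R, [/\ 0 <= K, 0 <= rho < 1 &
    forall z n, y0 < complex.Im z < y1 ->
      normc (f z - psum a N n0 n z) <= K * rho ^+ n].
Proof.
move=> N0 y00 H.
have NR : 0 < N%:R :> R by rewrite ltr0n.
pose z1 : C := 0 +i* (y0 / 2).
have z10 : uhp z1 by rewrite /uhp/= divr_gt0.
pose t i := a (expo N n0 i) * qpow (expo N n0 i) z1.
have [K0 K00 HK0] : exists2 K0 : R, 0 <= K0 & forall i, normc (t i) <= K0.
  have [n1 H1] := H z1 z10 1 ltr01.
  have S0 : 0 <= \sum_(0 <= i < n1) normc (t i).
    by apply: sumr_ge0 => i _; exact: normc_ge0.
  exists (2 + \sum_(0 <= i < n1) normc (t i)); first by rewrite addr_ge0.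
  move=> i; have [i1|i1] := ltnP i n1.
    rewrite (bigD1_seq i) ?mem_index_iota ?iota_uniq//=.
    have : 0 <= \sum_(0 <= j < n1 | j != i) normc (t j).
      by apply: sumr_ge0 => j _; exact: normc_ge0.
    lra.
  have := H1 _ i1; have := H1 _ (leqW i1).
  have -> : psum a N n0 i.+1 z1 = psum a N n0 i z1 + t i.
    by rewrite /psum big_nat_recr.
  set s := psum _ _ _ _ _ => E1 E2.
  have -> : t i = (s + t i - f z1) - (s - f z1) by ring.
  apply: le_trans (normc_triangle _ _) _; rewrite normc_opp; lra.
pose K1 := expR (2 * pi * `|n0%:~R / N%:R| * y1) : R.
pose rho := expR (- (pi * y0 / N%:R)) : R.
have rho01 : 0 <= rho < 1.
  by rewrite expR_ge0 expR_lt1 oppr_lt0 divr_gt0 ?mulr_gt0 ?pi_gt0.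
have K10 : 0 <= K1 := expR_ge0 _.
have r10 : 0 < 1 - rho by rewrite subr_gt0; case/andP: rho01.
have term z i : y0 < complex.Im z < y1 ->
    normc (a (expo N n0 i) * qpow (expo N n0 i) z) <= K0 * K1 * rho ^+ i.
  move=> /andP[zy0 zy1].
  have -> : qpow (expo N n0 i) z =
      qpow (expo N n0 i) z1 * qpow (expo N n0 i) (z - z1).
    by rewrite -qpow_addz; congr qpow; ring.
  rewrite mulrA Normc.normcM -mulrA.
  apply: ler_pM; [exact: normc_ge0 | exact: normc_ge0 | exact: HK0 |].
  rewrite normc_qpow /rho -expRM_natl /K1 -expRD ler_expR.
  rewrite /expo rmorphM/= fmorphV/= ratr_nat ratr_int intrD.
  rewrite cImD cImN /=.
  set d := complex.Im z - y0 / 2.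
  have d1 : d <= y1 by rewrite /d; lra.
  have d2 : y0 / 2 <= d by rewrite /d; lra.
  have d0 : 0 <= d by lra.
  have -> : - (2 * pi * ((n0%:~R + i%:R) / N%:R) * d) =
    2 * pi * (- (n0%:~R / N%:R)) * d - i%:R * (2 * pi * d / N%:R) :> R.
    by field; rewrite gt_eqF.
  have p0 : 0 <= pi :> R by rewrite ltW// pi_gt0.
  apply: lerD.
    rewrite -!mulrA; do 2 apply: ler_wpM2l => //.
    set q := _ / N%:R.
    have q1 : - q <= `|q| by rewrite -normrN ler_norm.
    exact: le_trans (ler_wpM2r d0 q1) (ler_wpM2l (normr_ge0 _) d1).
  rewrite mulrN lerN2; apply: ler_wpM2l; first exact: ler0n.
  apply: ler_wpM2r; first by rewrite invr_ge0 ler0n.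
  have := ler_wpM2l p0 d2; lra.
exists (K0 * K1 / (1 - rho)), rho; split=> //.
  by rewrite divr_ge0 ?mulr_ge0// ltW.
move=> z n zS.
have z0 : uhp z by rewrite /uhp/=; case/andP: zS => /(lt_trans y00).
apply: (@tends_le _ _ _ _ _ n (H z z0)) => m nm.
have -> : psum a N n0 m z - psum a N n0 n z =
    \sum_(n <= i < m) a (expo N n0 i) * qpow (expo N n0 i) z.
  by rewrite /psum (@big_cat_nat _ _ _ n 0 m _ _ (leq0n n) nm)/=; ring.
apply: le_trans (normc_sum _ _ _) _.
apply: (@le_trans _ _ (\sum_(n <= i < m) K0 * K1 * rho ^+ i)).
  by apply: ler_sum => i _; exact: term.
rewrite -mulr_sumr -[_ / _ * _]mulrA [_^-1 * _]mulrC.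
apply: ler_wpM2l; first exact: mulr_ge0.
exact: (geometric_tail rho01 nm).
Qed.

Lemma psum_mul_cvg u v A B N n0 M m0 : (0 < N)%N -> (0 < M)%N ->
  (forall z, uhp z -> tends (fun n => psum A N n0 n z) (u z)) ->
  (forall z, uhp z -> tends (fun n => psum B M m0 n z) (v z)) ->
  strip_cvg (fun n z => psum A N n0 n z * psum B M m0 n z) (fun z => u z * v z).
Proof.
move=> N0 M0 Hu Hv y0 y1 e y00 e0.
have [K [r [K0 r01 HK]]] := psum_geometric y1 N0 y00 Hu.
have [L [s [L0 s01 HL]]] := psum_geometric y1 M0 y00 Hv.
have KL0 : 0 <= K * L by rewrite mulr_ge0.
have e20 : 0 < e / 2 by rewrite divr_gt0.
have [n1 H1] := geometric_small s01 e20 KL0.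
have [n2 H2] := geometric_small r01 e20 (mulr_ge0 (ler0n R 2) KL0).
exists (maxn n1 n2) => n; rewrite geq_max => /andP[/H1{}H1 /H2{}H2] z zS.
have uK : normc (u z) <= K.
  by have := HK z 0 zS; rewrite /psum big_geq// subr0 expr0 mulr1.
have vL : normc (v z) <= L.
  by have := HL z 0 zS; rewrite /psum big_geq// subr0 expr0 mulr1.
have {}HK := HK z n zS; have {}HL := HL z n zS.
have sL : normc (psum B M m0 n z) <= 2 * L.
  have -> : psum B M m0 n z = v z - (v z - psum B M m0 n z) by ring.
  apply: le_trans (normc_triangle _ _) _; rewrite normc_opp.
  have : L * s ^+ n <= L.
    by rewrite ler_piMr// exprn_ile1//; case/andP: s01 => // _ /ltW.
  lra.
have -> : u z * v z - psum A N n0 n z * psum B M m0 n z =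
  u z * (v z - psum B M m0 n z) + (u z - psum A N n0 n z) * psum B M m0 n z by ring.
apply: le_trans (normc_triangle _ _) _; rewrite !Normc.normcM.
have := ler_pM (normc_ge0 _) (normc_ge0 _) uK HL.
have := ler_pM (normc_ge0 _) (normc_ge0 _) HK sL.
lra.
Qed.

(** The primitive of q^r; the exponent 0 is what makes it aperiodic. *)
Definition qprim (r : rat) z : C :=
  if r == 0 then z else (freq R r)^-1 * qpow r z.

Lemma has_deriv_qprim r z : has_deriv (qprim r) z (qpow r z).
Proof.
rewrite /qprim; have [->|r0] := eqVneq r 0.
  rewrite qpow0; have := has_deriv_affine 1 0 z.
  by under eq_fun do rewrite mul1r addr0.
have := has_derivZ (freq R r)^-1 (has_deriv_qpow r z).
by rewrite mulKf// freq_eq0.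
Qed.

Lemma qprim_period r (k : nat) (n : int) z : r * k%:R = n%:~R ->
  qprim r (z + k%:R) - qprim r z = k%:R * (r == 0)%:R.
Proof.
move=> rk; rewrite /qprim; have [_|r0] := eqVneq r 0.
  by rewrite mulr1; ring.
by rewrite (qpow_nat_period _ rk) subrr mulr0.
Qed.

(** A finitely supported sum does not depend on the finite index set that is
    taken; this identifies the constant term found by indices of the two series
    with its description by exponents. *)
Lemma big_uniq_supp (I : eqType) (V : nmodType) (h : I -> V) (s t : seq I) :
  uniq s -> uniq t -> (forall x, h x != 0 -> x \in s) ->
  (forall x, h x != 0 -> x \in t) -> \sum_(x <- s) h x = \sum_(x <- t) h x.
Proof.
move=> us ut hs ht.
rewrite (bigID (fun x => h x != 0)) [RHS](bigID (fun x => h x != 0)) /=.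
rewrite [X in _ + X]big1 ?[X in _ = _ + X]big1; try by move=> x /negPn/eqP.
rewrite !addr0 -big_filter -[RHS]big_filter; apply: perm_big.
apply: uniq_perm; rewrite ?filter_uniq// => x.
rewrite !mem_filter; case: (boolP (h x != 0)) => //= h0.
by rewrite hs// ht.
Qed.

Lemma expo_inj N n0 : (0 < N)%N -> injective (expo N n0).
Proof.
move=> N0 i j; have NQ : N%:R != 0 :> rat by rewrite pnatr_eq0 -lt0n.
by move=> /(divIf NQ) /intr_inj /addrI [].
Qed.

(** The products of partial sums of u and v are finite sums of powers of q, with
    explicit primitives, so [primitive_limit] applies and no rearrangement of the
    double series is needed. Translation by a common denominator of all
    the exponents only affects the terms of exponent 0, which add up to c. *)
Lemma qexpansion_mul_primitive u v A B : qexpansion u A -> qexpansion v B ->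
  exists Q (N : nat) c, [/\ (0 < N)%N,
    forall z, uhp z -> has_deriv Q z (u z * v z),
    forall z (k : nat), uhp z ->
      Q (z + (k * N)%:R) = Q z + (k * N)%:R * c &
    forall s : seq rat, uniq s -> (forall x, A x * B (- x) != 0 -> x \in s) ->
      c = \sum_(x <- s) A x * B (- x)].
Proof.
move=> /qexpansion_tends[N [n0 [N0 sA Hu]]] /qexpansion_tends[M [m0 [M0 sB Hv]]].
have NQ : 0 < N%:R :> rat by rewrite ltr0n.
have MQ : 0 < M%:R :> rat by rewrite ltr0n.
pose x := expo N n0; pose y := expo M m0.
(* Two exponents can only cancel if both indices are below this bound. *)
pose b := (`|n0| * M + `|m0| * N).+1.
have xy_bound i j : x i = - y j -> (i < b)%N /\ (j < b)%N.
  move=> /(congr1 (fun r => r * (N%:R * M%:R))).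
  rewrite /x /y /expo => E.
  have {}E : (n0 + i%:Z) * M%:Z = - (m0 + j%:Z) * N%:Z.
    apply: (@intr_inj rat).
    rewrite !rmorphM/= rmorphN/= -!pmulrn.
    move: E; rewrite mulrA divfK ?gt_eqF// => ->.
    by field; rewrite gt_eqF.
  by rewrite /b; split; nia.
pose c := \sum_(r <- map x (iota 0 b)) A r * B (- r).
have suppc r : A r * B (- r) != 0 -> exists i, [/\ r = x i, (i < b)%N &
    exists j, - r = y j].
  rewrite mulf_eq0 negb_or => /andP[/sA[i ri] /sB[j rj]]; exists i.
  have [] : (i < b)%N /\ (j < b)%N.
    by apply: xy_bound; rewrite /x -ri /y -rj opprK.
  by split=> //; exists j.
have ux n : uniq (map x (iota 0 n)).
  by rewrite map_inj_uniq ?iota_uniq//; exact: expo_inj.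
have suppn n : (b <= n)%N -> forall r, A r * B (- r) != 0 -> r \in map x (iota 0 n).
  move=> bn r /suppc[i [-> ib _]]; apply: map_f.
  by rewrite mem_iota add0n (leq_trans ib).
pose Qn n z := \sum_(0 <= i < n) \sum_(0 <= j < n)
  A (x i) * B (y j) * qprim (x i + y j) z.
have [] := @primitive_limit R (fun n z => psum A N n0 n z * psum B M m0 n z)
  Qn (fun z => u z * v z).
- move=> n z z0.
  have -> : psum A N n0 n z * psum B M m0 n z = \sum_(0 <= i < n)
      \sum_(0 <= j < n) A (x i) * B (y j) * qpow (x i + y j) z.
    rewrite /psum big_distrlr /=; apply: eq_bigr => i _; apply: eq_bigr => j _.
    by rewrite qpowD mulrACA.
  apply: has_deriv_sum => i; apply: has_deriv_sum => j.
  exact/has_derivZ/has_deriv_qprim.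
- exact: psum_mul_cvg.
move=> Q [Qd Qlim]; exists Q, (N * M)%N, c; split=> //.
- by rewrite muln_gt0 N0.
- move=> z k z0.
  suff E : Q (z + (k * (N * M))%:R) - Q z = (k * (N * M))%:R * c.
    by rewrite -E; ring.
  apply: (Qlim _ _ _ b) => //.
    by rewrite /uhp/= -(rmorph_nat (real_complex R)) cImD addr0.
  move=> n bn.
  have -> : Qn n (z + (k * (N * M))%:R) - Qn n z = (k * (N * M))%:R *
      \sum_(0 <= i < n) A (x i) * \sum_(0 <= j < n) B (y j) * (x i + y j == 0)%:R.
    rewrite /Qn -sumrB mulr_sumr; apply: eq_bigr => i _.
    rewrite -sumrB !mulr_sumr; apply: eq_bigr => j _.
    pose e : int := k%:Z * ((n0 + i%:Z) * M%:Z + (m0 + j%:Z) * N%:Z).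
    have xye : (x i + y j) * (k * (N * M))%:R = e%:~R.
      rewrite /x /y /expo !natrM /e !(intrM, intrD) -!pmulrn.
      by field; rewrite !gt_eqF.
    by rewrite -mulrBr (qprim_period _ xye); ring.
  congr (_ * _); rewrite /c.
  rewrite -(big_uniq_supp (ux n) (ux b) (suppn n bn) (suppn b (leqnn b))).
  rewrite big_map /index_iota subn0; apply: eq_bigr => i _; congr (_ * _).
  have [Bx|Bx] := eqVneq (B (- x i)) 0.
    rewrite Bx big1// => j _; have [xy|] := eqVneq (x i + y j) 0.
      by rewrite (_ : y j = - x i) ?Bx ?mul0r//; apply/eqP; rewrite -addr_eq0 addrC xy.
    by rewrite mulr0.
  have [j xj] := sB _ Bx; have xj' : x i = - y j by rewrite /y -xj opprK.
  have [ib jb] := xy_bound _ _ xj'.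
  rewrite (bigD1_seq j) ?iota_uniq ?mem_iota ?add0n ?(leq_trans jb)//=.
  rewrite {1}xj' addNr eqxx mulr1 big1 ?addr0 ?xj// => l lj.
  rewrite (_ : _ == 0 = false) ?mulr0//; apply/negbTE.
  by rewrite addrC addr_eq0 xj' opprK (inj_eq (expo_inj M0)).
- move=> s us ss; apply: big_uniq_supp => //; exact: suppn.
Qed.

End Expansions.

(** * Moebius transformations of the upper half-plane *)

Section Moebius.
Variable R : realType.
Local Notation C := R[i].
Local Notation normc := (@Normc.normc R).
Local Notation M2 := 'M[R]_2.
Implicit Types (g h : M2) (z w : C).

Lemma mx2P g h : g 0 0 = h 0 0 -> g 0 1 = h 0 1 -> g 1 0 = h 1 0 ->
  g 1 1 = h 1 1 -> g = h.
Proof.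
move=> h00 h01 h10 h11; apply/matrixP => i j.
have two (k : 'I_2) : k = 0 \/ k = 1.
  by case: k => [[|[|//]] ?]; [left|right]; exact: val_inj.
by case: (two i) => ->; case: (two j) => ->.
Qed.

Lemma mulmx2E g h i j : (g *m h) i j = g i 0 * h 0 j + g i 1 * h 1 j.
Proof.
rewrite mxE !big_ord_recl big_ord0 addr0.
by congr (_ * _ + g _ _ * h _ _); exact: val_inj.
Qed.

Lemma SL2E g : SL2 g <-> g 0 0 * g 1 1 - g 0 1 * g 1 0 = 1.
Proof.
suff E : \det g = g 0 0 * g 1 1 - g 0 1 * g 1 0 by rewrite /SL2/= E.
rewrite (expand_det_row _ 0) !big_ord_recl big_ord0 addr0 /cofactor !det_mx11 !mxE /=.
rewrite expr0 expr1 mul1r mulN1r mulrN.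
by congr (g _ _ * g _ _ - g _ _ * g _ _); exact: val_inj.
Qed.

(** The adjugate, whose entries are visibly integers when those of g are. *)
Definition sl2inv g : M2 :=
  \matrix_(i, j) (if i != j then - g i j else if i == 0 then g 1 1 else g 0 0).

Lemma one2E i j : (1%:M : M2) i j = (i == j)%:R. Proof. by rewrite mxE. Qed.

Lemma mul_sl2inv g : SL2 g -> g *m sl2inv g = 1%:M.
Proof.
move=> /SL2E d; apply: mx2P; rewrite mulmx2E !mxE /= ?subr0 ?subrr//; move: d; lra.
Qed.

Lemma sl2invE g : SL2 g -> invmx g = sl2inv g.
Proof.
move=> gS; have gU : g \in unitmx by rewrite unitmxE (gS : \det g = 1) unitr1.
by rewrite -[RHS](mulKmx gU) mul_sl2inv// mulmx1.
Qed.

Lemma SL2_mul g h : SL2 g -> SL2 h -> SL2 (g *m h).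
Proof. by move=> gS hS; rewrite /SL2/= det_mulmx gS hS mulr1. Qed.

Lemma SL2_unit g : SL2 g -> g \in unitmx.
Proof. by move=> gS; rewrite unitmxE (gS : \det g = 1) unitr1. Qed.

Lemma SL2_inv g : SL2 g -> SL2 (invmx g).
Proof. by move=> gS; rewrite /SL2/= det_inv gS invr1. Qed.

Lemma SL2Z_mul g h : SL2Z g -> SL2Z h -> SL2Z (g *m h).
Proof.
move=> [gS gZ] [hS hZ]; split; first exact: SL2_mul.
by move=> i j; rewrite mulmx2E rpredD ?rpredM.
Qed.

Lemma SL2Z_inv g : SL2Z g -> SL2Z (invmx g).
Proof.
move=> [gS gZ]; split; first exact: SL2_inv.
by move=> i j; rewrite sl2invE// mxE; case: ifP => _; [rewrite rpredN | case: ifP].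
Qed.

Lemma SL2Z_1 : SL2Z (1%:M : M2).
Proof.
by split=> [|i j]; [rewrite /SL2/= det1 | rewrite one2E rpred_nat].
Qed.

Lemma translE (r : R) : [/\ transl r 0 0 = 1, transl r 0 1 = r,
  transl r 1 0 = 0 & transl r 1 1 = 1].
Proof. by rewrite /transl; split; rewrite !mxE /= ?mulr0 ?mulr1 ?addr0 ?add0r. Qed.

Lemma SL2Z_transl (n : nat) : SL2Z (transl n%:R : M2).
Proof.
have [h00 h01 h10 h11] := translE n%:R.
split; first by apply/SL2E; rewrite h00 h01 h10 h11; ring.
move=> i j; rewrite /transl !mxE.
by rewrite rpredD// ?rpredM// ?rpred_nat//; case: (_ == _).
Qed.

Lemma translD (r s : R) : transl (r + s) = transl r *m transl s.
Proof.
have [a1 a2 a3 a4] := translE r; have [b1 b2 b3 b4] := translE s.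
have [c1 c2 c3 c4] := translE (r + s).
by apply: mx2P; rewrite mulmx2E ?a1 ?a2 ?a3 ?a4 ?b1 ?b2 ?b3 ?b4 ?c1 ?c2 ?c3 ?c4; ring.
Qed.

Lemma transl0 : transl 0 = 1%:M :> M2.
Proof. by rewrite /transl scale0r addr0. Qed.

Lemma Im_real_mul (a : R) z : complex.Im (a%:C * z) = a * complex.Im z.
Proof. by rewrite cImM/= mul0r addr0. Qed.

Lemma cden_neq0 g z : SL2 g -> uhp z -> cden g z != 0.
Proof.
move=> /SL2E d z0; apply/eqP => E.
have := congr1 (@complex.Im R) E; rewrite /cden cImD Im_real_mul /= addr0.
move=> /eqP; rewrite mulf_eq0 => /orP[/eqP c0|/eqP y0]; last first.
  by move: z0; rewrite /uhp/= y0 ltxx.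
move: E; rewrite /cden c0 rmorph0 mul0r add0r => /complexI d0.
by move: d; rewrite c0 d0; lra.
Qed.

Lemma mobius_transl (r : R) z : mobius (transl r) z = z + r%:C.
Proof.
have [a1 a2 a3 a4] := translE r.
by rewrite /mobius /cden a1 a2 a3 a4 rmorph0 rmorph1 mul0r add0r divr1 mul1r.
Qed.

Lemma mobius_cden g z : SL2 g -> uhp z ->
  mobius g z * cden g z = (g 0 0)%:C * z + (g 0 1)%:C.
Proof. by move=> gS z0; rewrite /mobius divfK ?cden_neq0. Qed.

Lemma cden_mul g h z : SL2 h -> uhp z ->
  cden (g *m h) z = cden g (mobius h z) * cden h z.
Proof.
move=> hS z0; have h0 := cden_neq0 hS z0.
rewrite [cden (g *m h) z]/cden !mulmx2E !rmorphD/= !rmorphM/=.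
rewrite [cden g _]/cden [RHS]mulrDl -[_ * mobius h z * _]mulrA mobius_cden// /cden; ring.
Qed.

Lemma mobius_mul g h z : SL2 g -> SL2 h -> uhp z ->
  mobius (g *m h) z = mobius g (mobius h z).
Proof.
move=> gS hS z0; have h0 := cden_neq0 hS z0.
have gh0 := cden_neq0 (SL2_mul gS hS) z0.
rewrite [LHS]/mobius cden_mul// !mulmx2E !rmorphD/= !rmorphM/=.
rewrite -[RHS]mulr1 -(divff h0) [RHS]mulf_div; congr (_ / _).
rewrite [RHS]mulrDl -[_ * mobius h z * _]mulrA mobius_cden// /cden; ring.
Qed.

Lemma mobius_uhp g z : SL2 g -> uhp z -> uhp (mobius g z).
Proof.
move=> gS z0; have := cden_neq0 gS z0; move/SL2E: gS => d.
rewrite -normc_gt0 /uhp /mobius /cden; case: z z0 => x y; rewrite /uhp/= => y0.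
rewrite !mul0r !addr0 !subr0 sqrtr_gt0; set n2 := _ ^+ 2 + _ => n0.
rewrite (_ : _ + _ = (g 0 0 * g 1 1 - g 0 1 * g 1 0) * y / n2); last by ring.
by rewrite d mul1r divr_gt0.
Qed.

Lemma mobius1 z : mobius 1%:M z = z.
Proof. by rewrite -transl0 mobius_transl rmorph0 addr0. Qed.

Lemma mobius_upper g z : SL2 g -> g 1 0 = 0 ->
  mobius g z = (g 0 0 ^+ 2)%:C * z + (g 0 0 * g 0 1)%:C.
Proof.
move=> /SL2E d c0; rewrite c0 mulr0 subr0 in d.
have d0 : (g 1 1)%:C != 0 :> C.
  by apply/eqP => /complexI E; move: d; rewrite E; lra.
rewrite /mobius /cden c0 rmorph0 mul0r add0r; apply: (mulIf d0); rewrite divfK//.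
have -> : (g 0 0 ^+ 2)%:C = (g 0 0)%:C * (g 0 0)%:C :> C by rewrite -rmorphM expr2.
have dC : (g 0 0)%:C * (g 1 1)%:C = 1 :> C by rewrite -rmorphM/= d.
rewrite rmorphM/= -[z in LHS]mul1r -[(g 0 1)%:C in LHS]mul1r -dC; ring.
Qed.

(** For c = 0 the transformation is affine; otherwise it equals
    [a / c - c^-1 / (c z + d)], a composition of affine maps and inversion. *)
Lemma has_deriv_mobius g z : SL2 g -> uhp z ->
  has_deriv (mobius g) z (cden g z ^- 2).
Proof.
move=> gS z0; have h0 := cden_neq0 gS z0; have d := (SL2E g).1 gS.
have [c0|c0] := eqVneq (g 1 0) 0.
  apply: has_deriv_eq_uhp z0 (fun w _ => esym (mobius_upper w gS c0)) _.
  have -> : cden g z ^- 2 = (g 0 0 ^+ 2)%:C; last exact: has_deriv_affine.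
  rewrite c0 mulr0 subr0 in d.
  apply: (mulIf (expf_neq0 2 h0)); rewrite mulVf ?expf_neq0//.
  by rewrite /cden c0 rmorph0 mul0r add0r -rmorphXn -rmorphM/= -exprMn d expr1n.
have c0C : (g 1 0)%:C != 0 :> C by rewrite fmorph_eq0.
pose inner w := (g 1 0)%:C * w + (g 1 1)%:C.
apply: (@has_deriv_eq_uhp _ (fun w => - (g 1 0)%:C^-1 * (inner w)^-1 +
  (g 0 0)%:C / (g 1 0)%:C) _ _ _ z0).
  move=> w w0; have wd := cden_neq0 gS w0.
  rewrite /mobius /inner -/(cden g w).
  apply: (mulIf wd); rewrite divfK// mulrDl mulfVK//.
  have dC : (g 0 0)%:C * (g 1 1)%:C - (g 0 1)%:C * (g 1 0)%:C = 1 :> C.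
    by rewrite -!rmorphM -rmorphB/= d.
  have E : (g 1 0)%:C * ((g 0 0)%:C * w + (g 0 1)%:C) = (g 0 0)%:C * cden g w - 1.
    by rewrite -dC /cden; ring.
  by apply: (mulfI c0C); rewrite E; field.
have H := has_deriv_comp (has_deriv_comp (has_deriv_affine _ _ z) (has_deriv_inv h0))
  (has_deriv_affine (- (g 1 0)%:C^-1) ((g 0 0)%:C / (g 1 0)%:C) _).
have -> : cden g z ^- 2 = - (g 1 0)%:C^-1 * (- cden g z ^- 2 * (g 1 0)%:C).
  by field; rewrite h0.
exact: H.
Qed.

End Moebius.

(** * Cosets in SL2(Z) and primitives of weight 2 forms *)

Section Cosets.
Variable R : realType.
Local Notation M2 := 'M[R]_2.
Implicit Types (g h s : M2) (X : set M2).

Definition translate s X : set M2 := [set s *m x | x in X].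

Lemma translate_mul s t X : translate s (translate t X) = translate (s *m t) X.
Proof.
apply/seteqP; split=> [_ [_ [x Xx <-] <-]|_ [x Xx <-]].
  by exists x => //; rewrite mulmxA.
by exists (t *m x); [exists x | rewrite mulmxA].
Qed.

Lemma translate1 X : translate 1%:M X = X.
Proof.
apply/seteqP; split=> [_ [x Xx <-]|x Xx]; first by rewrite mul1mx.
by exists x => //; rewrite mul1mx.
Qed.

Lemma translateK s X : s \in unitmx -> translate (invmx s) (translate s X) = X.
Proof. by move=> su; rewrite translate_mul mulVmx// translate1. Qed.

(** The left cosets of H are listed as sets, so that left multiplication acts on
    the list itself, as a permutation; the representatives only serve to write
    down functions on the half-plane. *)
Lemma coset_representatives (G : set M2) : commensurable G ->
  exists (cs : seq (set M2)) (rep : set M2 -> M2),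
  let H := G `&` @SL2Z R in
  [/\ uniq cs, H \in cs,
      forall X, X \in cs -> SL2Z (rep X) /\ X = translate (rep X) H,
      forall s, SL2Z s -> perm_eq (map (translate s) cs) cs &
      forall X x, X \in cs -> X x -> exists2 h, G h & x = rep X *m h].
Proof.
move=> [GS [G1 GM GV] _ /finite_seqP[cs0 cs0E]].
set H := G `&` @SL2Z R in cs0E *.
have csP X : X \in undup cs0 <-> exists2 g, SL2Z g & X = translate g H.
  rewrite mem_undup; have -> : (X \in cs0) <-> [set` cs0] X by [].
  by rewrite -cs0E; split=> -[g gS E]; exists g.
have /choice[rep repP] : forall X, exists g, X \in undup cs0 ->
    SL2Z g /\ X = translate g H.
  move=> X; have [/csP[g gS ->]|] := boolP (X \in undup cs0); last by exists 1%:M.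
  by exists g.
exists (undup cs0), rep; rewrite -/H; split=> //.
- exact: undup_uniq.
- by apply/csP; exists 1%:M; rewrite ?translate1//; exact: SL2Z_1.
- move=> s sS; have su : s \in unitmx by apply: SL2_unit; case: sS.
  have sI : injective (translate s).
    by move=> X Y /(congr1 (translate (invmx s))); rewrite !translateK.
  apply: uniq_perm; rewrite ?(map_inj_uniq sI) ?undup_uniq// => X.
  apply/mapP/idP => [[Y /csP[g gS ->] ->]|/csP[g gS ->]].
    by apply/csP; exists (s *m g); rewrite ?translate_mul//; exact: SL2Z_mul.
  exists (translate (invmx s *m g) H).
    by apply/csP; exists (invmx s *m g) => //; apply: SL2Z_mul => //; exact: SL2Z_inv.
  by rewrite translate_mul mulmxA mulmxV// mul1mx.
- move=> X x Xcs; have [_ {1}->] := repP _ Xcs.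
  by move=> [h [Gh _] <-]; exists h.
Qed.

(** Pigeonhole: among the translates of X by 0, 1, 2, ... two must coincide, as
    they all lie in a finite list. *)
Lemma transl_stabilizer (cs : seq (set M2)) X :
  (forall k : nat, translate (transl k%:R) X \in cs) ->
  exists2 L : nat, (0 < L)%N & translate (transl L%:R) X = X.
Proof.
move=> Xcs; pose r := [seq translate (transl k%:R) X | k <- iota 0 (size cs).+1].
have : ~~ uniq r.
  apply/negP => /uniq_leq_size => /(_ cs); rewrite size_map size_iota ltnn.
  by move=> /(_ _)/negP[]// _ /mapP[k _ ->].
move=> /(uniqPn set0)[i [j [ij]]]; rewrite size_map size_iota => js.
rewrite !(nth_map 0%N) ?size_iota// ?(ltn_trans ij)//.
rewrite !nth_iota ?(ltn_trans ij)// !add0n.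
rewrite -(subnKC (ltnW ij)) natrD translD -translate_mul => E.
exists (j - i)%N; first by rewrite subn_gt0.
have [/SL2_unit iu _] := SL2Z_transl R i.
by rewrite -[RHS](translateK _ iu) E translateK.
Qed.

End Cosets.

Section WeightTwo.
Variable R : realType.
Local Notation C := R[i].
Local Notation M2 := 'M[R]_2.
Implicit Types (g h : M2) (z w : C) (P Q F : C -> C).

Lemma uhp_i : uhp ('i%C : C). Proof. by rewrite /uhp/=. Qed.

Lemma uhpDreal z (x : R) : uhp z -> uhp (z + x%:C).
Proof. by rewrite /uhp/= cImD /= addr0. Qed.

Lemma natC (n : nat) : n%:R = (n%:R)%:C :> C.
Proof. by rewrite rmorph_nat. Qed.

Definition primitive P F := forall z, uhp z -> has_deriv P z (F z).

(** Weight 2 is the weight for which composing a primitive with g corresponds to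
    the slash action of g, because the derivative of g is [(c z + d)^-2]. *)
Lemma primitive_comp P F g : SL2 g -> primitive P F ->
  primitive (fun z => P (mobius g z)) (fun z => F (mobius g z) * cden g z ^- 2).
Proof.
move=> gS PF z z0.
exact: has_deriv_comp (has_deriv_mobius gS z0) (PF _ (mobius_uhp gS z0)).
Qed.

Lemma primitive_unique P Q F : primitive P F -> primitive Q F ->
  forall z w, uhp z -> uhp w -> P w - P z = Q w - Q z.
Proof.
move=> PF QF z w z0 w0.
have /(_ _ _ z0 w0) : forall z w, uhp z -> uhp w -> P z - Q z = P w - Q w.
  apply: zero_deriv_const => {}z {}z0.
  by have := has_derivB (PF _ z0) (QF _ z0); rewrite subrr.
move=> E.
have -> : P w = (P w - Q w) + Q w by ring.
by rewrite -E; ring.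
Qed.

(** Under the translations by multiples of some M, p moves like the linear
    function [t c z]. The period M is existential so that drifts of functions
    with different periods can be added. *)
Definition drifts (c : C) (p : C -> C) (t : R) := exists2 M : nat, (0 < M)%N &
  forall z (k : nat), uhp z ->
    p (z + (k * M)%:R) = p z + (k * M)%:R * (t%:C * c).

Lemma driftsD c p q t s : drifts c p t -> drifts c q s ->
  drifts c (fun z => p z + q z) (t + s).
Proof.
move=> [M M0 Hp] [N N0 Hq]; exists (M * N)%N; first by rewrite muln_gt0 M0.
move=> z k z0.
have := Hp z (k * N)%N z0; have := Hq z (k * M)%N z0.
rewrite -!mulnA (mulnC N) => -> ->; rewrite rmorphD/=; ring.
Qed.

(** No cancellation can occur among the nonnegative drifts of the summands: one
    index with [inf] is enough to make the total positive. *)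
Lemma drifts_sum (I : eqType) c (r : seq I) (p : I -> C -> C) (inf : I -> Prop) :
  (forall i, i \in r -> exists t : R,
     [/\ 0 <= t, inf i -> 0 < t & drifts c (p i) t]) ->
  exists t : R, [/\ 0 <= t, (exists2 i, i \in r & inf i) -> 0 < t &
    drifts c (fun z => \sum_(i <- r) p i z) t].
Proof.
elim: r => [|i r IH] H.
  exists 0; split=> //; first by case.
  by exists 1%N => // z k z0; rewrite !big_nil !mul0r mulr0 addr0.
have [|t [t0 tI tD]] := IH; first by move=> j jr; apply: H; rewrite inE jr orbT.
have [s [s0 sI sD]] := H i (mem_head _ _).
exists (s + t); split; first exact: addr_ge0.
  move=> [j]; rewrite inE => /orP[/eqP -> /sI|jr jI]; first by lra.
  by have : 0 < t by [apply: tI; exists j]; lra.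
have -> : (fun z => \sum_(j <- i :: r) p j z) = fun z => p i z + \sum_(j <- r) p j z.
  by apply/funext => z; rewrite big_cons.
exact: driftsD.
Qed.

(** [t = g^-1 u] fixes infinity. *)
Lemma same_boundary_upper g u t : SL2 g -> SL2 u -> u = g *m t ->
  mobius_bd g None = mobius_bd u None -> t 1 0 = 0.
Proof.
move=> gS uS E bd.
have {bd} : g 0 0 * u 1 0 = g 1 0 * u 0 0.
  move: bd; rewrite /mobius_bd.
  have [-> |g0] := eqVneq (g 1 0) 0; have [-> |u0] := eqVneq (u 1 0) 0 => //.
    by rewrite mulr0 mul0r.
  by case=> H; rewrite -[g 0 0](divfK g0) H; field.
rewrite E !mulmx2E; move/SL2E: gS => d H.
rewrite -[LHS]mul1r -d; move: H; lra.
Qed.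

(** An upper triangular t acts by [z |-> t00^2 z + t00 t01], so it conjugates a
    translation into the translation scaled by [t00^2]. *)
Lemma transl_conj t (r : R) : SL2 t -> t 1 0 = 0 ->
  transl (t 0 0 ^+ 2 * r) *m t = t *m transl r.
Proof.
move=> /SL2E d c0; rewrite c0 mulr0 subr0 in d.
have [a1 a2 a3 a4] := translE r.
have [b1 b2 b3 b4] := translE (t 0 0 ^+ 2 * r).
apply: mx2P; rewrite !mulmx2E ?a1 ?a2 ?a3 ?a4 ?b1 ?b2 ?b3 ?b4 ?c0; try by ring.
have -> : t 0 0 ^+ 2 * r * t 1 1 = t 0 0 * r * (t 0 0 * t 1 1) by ring.
by rewrite d; ring.
Qed.

(** P has drift 1 along multiples of N, but the argument [a z + b] moves by
    multiples of the real number a. That [a L] is rational for some L makes a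
    suitable multiple of a an integral multiple of N. *)
Lemma upper_drifts (P : C -> C) (c : C) (N L : nat) (a b : R) :
  (0 < N)%N -> (0 < L)%N -> 0 < a ->
  (forall z (k : nat), uhp z -> P (z + (k * N)%:R) = P z + (k * N)%:R * c) ->
  (exists (q : rat) (n : int), 0 < q /\ a * L%:R = n%:~R * ratr q) ->
  drifts c (fun z => P (a%:C * z + b%:C)) a.
Proof.
move=> N0 L0 a0 PN [q [n [q0 E]]].
have aL0 : 0 < a * L%:R by rewrite mulr_gt0// ltr0n.
have n0 : 0 < n.
  have : 0 < ratr q :> R by rewrite ltr0q.
  by move: aL0; rewrite E => + qR; rewrite pmulr_lgt0// ltr0z.
have d0 : 0 < denq q by exact: denq_gt0.
have p0 : 0 < numq q by rewrite numq_gt0.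
(* With a L = n q, translation of z by this period moves a z by N n numq(q). *)
exists (L * N * `|denq q|)%N; first by rewrite !muln_gt0 L0 N0 absz_gt0 gt_eqF.
move=> z k z0.
have aM : (a * (k * (L * N * `|denq q|))%:R)%:C = (k * `|n| * `|numq q| * N)%:R :> C.
  rewrite natC; congr (_%:C).
  have nE : (`|n|%:R : R) = n%:~R by rewrite pmulrn gtz0_abs.
  have pE : (`|numq q|%:R : R) = (numq q)%:~R by rewrite pmulrn gtz0_abs.
  have dE : (`|denq q|%:R : R) = (denq q)%:~R by rewrite pmulrn gtz0_abs.
  have dn0 : (denq q)%:~R != 0 :> R by rewrite intr_eq0 denq_neq0.
  rewrite !natrM nE pE dE.
  have -> : a * (k%:R * (L%:R * N%:R * (denq q)%:~R)) =
    (a * L%:R) * (k%:R * N%:R * (denq q)%:~R) by ring.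
  by rewrite E /ratr; field.
have zE : a%:C * (z + (k * (L * N * `|denq q|))%:R) + b%:C =
   a%:C * z + b%:C + (k * `|n| * `|numq q| * N)%:R.
  by rewrite -aM !natC rmorphM; ring.
rewrite zE PN; last first.
  by apply: uhpDreal; rewrite /uhp/= Im_real_mul; apply: mulr_gt0.
by rewrite -aM !natC rmorphM; ring.
Qed.

End WeightTwo.

(** * The constant term of a weight 2 form *)

Section ConstantTerm.
Variable R : realType.
Local Notation C := R[i].
Local Notation M2 := 'M[R]_2.
Implicit Types (z w : C) (P Q F : C -> C).

Definition inversion : M2 := \matrix_(i, j) ((j < i)%N%:R - (i < j)%N%:R).

Lemma SL2Z_inversion : SL2Z inversion.
Proof.
split; first by apply/SL2E; rewrite !mxE /=; ring.
by move=> i j; rewrite mxE rpredB ?rpred_nat.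
Qed.

Lemma mobius_inversion z : mobius inversion z = - z^-1.
Proof.
rewrite /mobius /cden !mxE /= !subrr sub0r subr0 rmorphN rmorph1 rmorph0.
by rewrite mul0r add0r mul1r addr0 mulN1r.
Qed.

(** SL2(Z) has no nonzero homomorphism to the complex numbers. Only two
    evaluations are needed: at the fixed point i of the inversion, and at
    rho = exp(i pi / 3), where inversion and translation by - 1 agree. *)
Lemma periodic_of_cocycle (Phi : C -> C) :
  (forall s : M2, SL2Z s -> exists t, forall z, uhp z ->
     Phi (mobius s z) = Phi z + t) ->
  forall (k : nat) z, uhp z -> Phi (z + k%:R) = Phi z.
Proof.
move=> cocycle.
have [t Ht] := cocycle _ SL2Z_inversion.
have t0 : t = 0.
  have := Ht _ (uhp_i R); rewrite mobius_inversion.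
  rewrite (_ : - 'i%C^-1 = 'i%C).
    by move=> /eqP; rewrite -{1}[Phi 'i%C]addr0 (inj_eq (addrI _)) eq_sym => /eqP.
  have i0 : 'i%C != 0 :> C by rewrite eq_complex /= oner_eq0 andbF.
  by apply: (mulIf i0); rewrite mulNr mulVf// -expr2 sqr_i.
subst t.
have [t {}cocycle] := cocycle _ (SL2Z_transl R 1).
pose rho : C := 2^-1 +i* (Num.sqrt 3 / 2).
have rho0 : uhp rho by rewrite /uhp/= divr_gt0 ?sqrtr_gt0.
have rho1 : uhp (rho - 1).
  by rewrite -[1]/(1%:C) -rmorphN; exact: uhpDreal.
have rhoE : - rho^-1 = rho - 1.
  have rn : rho != 0 by apply/eqP => E; move: rho0; rewrite E /uhp/= ltxx.
  apply: (mulIf rn); rewrite mulNr mulVf//.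
  have s3 : Num.sqrt 3 ^+ 2 = 3 :> R by rewrite sqr_sqrtr.
  apply/eqP; rewrite eq_complex /=; apply/andP; split; apply/eqP; last by field.
  by move: s3; rewrite expr2; lra.
have {}t0 : t = 0.
  have := Ht _ rho0; rewrite mobius_inversion rhoE addr0.
  have := cocycle _ rho1; rewrite mobius_transl subrK => -> E.
  by move/eqP : E; rewrite -{1}[Phi (rho - 1)]addr0 (inj_eq (addrI _)) eq_sym => /eqP.
elim=> [|k IH] z z0; first by rewrite addr0.
rewrite mulrSr addrA -(IH z z0).
have := cocycle (z + k%:R); rewrite mobius_transl t0 addr0 => -> //.
by rewrite natC; exact: uhpDreal.
Qed.

(** The residue theorem on the compactified quotient, for a weight 2 form F with
    vanishing residues at the cusps other than infinity. A residue is encoded as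
    the obstruction to a primitive of the translated form being periodic, which
    is why the last hypothesis speaks of primitives. The argument is a transfer
    from G to SL2(Z): the sum Phi of the functions [P (r^-1 z)] over the cosets
    r H has period 1, while its drift is a positive multiple of c. *)
Theorem constant_term_weight2 (G : set M2) F P (N : nat) (c : C) (q : rat) :
  commensurable G -> is_width G q ->
  (forall g, G g -> forall z, uhp z -> F (mobius g z) = cden g z ^+ 2 * F z) ->
  primitive P F -> (0 < N)%N ->
  (forall z (k : nat), uhp z -> P (z + (k * N)%:R) = P z + (k * N)%:R * c) ->
  (forall u, SL2Z u ->
    ~ (exists2 g, G g & mobius_bd g None = mobius_bd u None) ->
    exists Q (M : nat), [/\ (0 < M)%N,
      primitive Q (fun z => F (mobius u z) * cden u z ^- 2) &
      forall z (k : nat), uhp z -> Q (z + (k * M)%:R) = Q z]) ->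
  c = 0.
Proof.
move=> hG [q0 hq] Fmod PF N0 PN cusps.
have [GS [G1 GM GV] _ _] := hG.
have [cs [rep [csu Hcs repP csperm repX]]] := coset_representatives hG.
have repS X : X \in cs -> SL2 (rep X) by move=> /repP[[]].
have invS X : X \in cs -> SL2 (invmx (rep X)) by move=> /repS; exact: SL2_inv.
have Pcocycle g : G g -> forall z, uhp z ->
    P (mobius g z) = P z + (P (mobius g 'i%C) - P 'i%C).
  move=> Gg z z0; have gS : SL2 g := GS _ Gg.
  have Pg : primitive (fun z => P (mobius g z)) F.
    move=> w w0; have := primitive_comp gS PF w0.
    by rewrite Fmod// mulrAC mulfV ?mul1r// expf_neq0// cden_neq0.
  have := primitive_unique Pg PF (uhp_i R) z0.
  move=> E; have -> : P (mobius g z) =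
    (P (mobius g z) - P (mobius g 'i%C)) + P (mobius g 'i%C) by ring.
  by rewrite E; ring.
pose Phi z := \sum_(X <- cs) P (mobius (invmx (rep X)) z).
have Phi_periodic : forall (k : nat) z, uhp z -> Phi (z + k%:R) = Phi z.
  apply: periodic_of_cocycle => s sZ; have sS : SL2 s by case: sZ.
  have [h hP] : exists h : set M2 -> M2, forall X, X \in cs ->
      G (h X) /\ s *m rep X = rep (translate s X) *m h X.
    have /choice[h hP] : forall X, exists h, X \in cs ->
        G h /\ s *m rep X = rep (translate s X) *m h.
      move=> X; have [Xcs|_] := boolP (X \in cs); last by exists 1%:M.
      have sX : translate s X \in cs.
        by rewrite -(perm_mem (csperm s sZ)); exact: map_f.
      have [h Gh E] : exists2 h, G h & s *m rep X = rep (translate s X) *m h.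
        apply: repX => //; exists (rep X) => //.
        have [rZ {1}->] := repP X Xcs; exists 1%:M; last by rewrite mulmx1.
        by split=> //; exact: SL2Z_1.
      by exists h.
    by exists h.
  exists (\sum_(X <- cs) (P (mobius (h X) 'i%C) - P 'i%C)) => z z0.
  rewrite /Phi -big_split /= -(perm_big _ (csperm s sZ)) big_map /=.
  rewrite big_seq [RHS]big_seq.
  apply: eq_bigr => X Xcs; have [Gh hE] := hP X Xcs.
  have sX : translate s X \in cs.
    by rewrite -(perm_mem (csperm s sZ)); exact: map_f.
  have hS := GS _ Gh.
  rewrite -Pcocycle//; last by apply: mobius_uhp => //; exact: invS.
  rewrite -!mobius_mul//; try by [exact: invS | exact: SL2_mul].
  congr (P (mobius _ _)).
  have ru := SL2_unit (repS _ sX).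
  apply: (can_inj (mulKmx ru)); rewrite (mulKVmx ru) mulmxA -hE.
  by rewrite -mulmxA (mulmxV (SL2_unit (repS _ Xcs))) mulmx1.
pose inf X := exists2 g, G g & mobius_bd g None = mobius_bd (invmx (rep X)) None.
(* Drift t00^2 at the cusps equivalent to infinity, and 0 at the others. *)
have drift X : X \in cs -> exists t : R, [/\ 0 <= t, inf X -> 0 < t &
    drifts c (fun z => P (mobius (invmx (rep X)) z)) t].
  move=> Xcs; have uS := invS _ Xcs.
  have [infX|ninf] := pselect (inf X); last first.
    have uZ : SL2Z (invmx (rep X)) by apply: SL2Z_inv; case: (repP _ Xcs).
    have [Q [M [M0 QF QM]]] := cusps _ uZ ninf.
    exists 0; split=> //; exists M => // z k z0.
    have zk : uhp (z + (k * M)%:R) by rewrite natC; exact: uhpDreal.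
    have := primitive_unique (primitive_comp uS PF) QF z0 zk.
    by rewrite QM// subrr => /eqP; rewrite subr_eq0 mul0r mulr0 addr0 => /eqP.
  have [g Gg gbd] := infX; have gS := GS _ Gg.
  set u := invmx (rep X) in uS gbd *.
  pose t := invmx g *m u.
  have tS : SL2 t by apply: SL2_mul => //; exact: SL2_inv.
  have ugt : u = g *m t by rewrite mulKVmx// SL2_unit.
  have t10 := same_boundary_upper gS uS ugt gbd.
  have [L L0 LX] : exists2 L : nat, (0 < L)%N & translate (transl L%:R) X = X.
    apply: (@transl_stabilizer _ cs) => k.
    by rewrite -(perm_mem (csperm _ (SL2Z_transl R k))); exact: map_f.
  have t00 : t 0 0 != 0.
    apply/eqP => E; move/SL2E : tS; rewrite E t10 !mul0r mulr0 subrr => /eqP.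
    by rewrite eq_sym oner_eq0.
  have t2 : 0 < t 0 0 ^+ 2 by rewrite exprn_even_gt0.
  exists (t 0 0 ^+ 2); split=> //; first exact: ltW.
  (* This translation is conjugate, by g, to the action of the translation by L
     seen at the cusp, which lies in G because it fixes the coset X; so the width
     of infinity makes [t00^2 L] rational. *)
  have Gtr : G (transl (t 0 0 ^+ 2 * L%:R)).
    have [h Gh hE] : exists2 h, G h & transl L%:R *m rep X = rep X *m h.
      apply: repX => //; rewrite -[X in X _]LX; exists (rep X) => //.
      have [rZ {1}->] := repP X Xcs; exists 1%:M; last by rewrite mulmx1.
      by split=> //; exact: SL2Z_1.
    have hE' : u *m transl L%:R = h *m u.
      rewrite /u -[h](mulKmx (SL2_unit (repS _ Xcs))) -hE -!mulmxA mulmxV ?mulmx1//.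
      exact/SL2_unit/repS.
    have -> : transl (t 0 0 ^+ 2 * L%:R) = invmx g *m h *m g.
      apply: (can_inj (mulmxK (SL2_unit tS))).
      by rewrite transl_conj// {1}/t -!mulmxA -ugt -hE' !mulmxA.
    exact: GM (GM _ _ (GV _ Gg) Gh) Gg.
  have [n nE] := (hq _).1 (or_introl Gtr).
  have [L' L'0 HL'] : drifts c
      (fun z => P ((t 0 0 ^+ 2)%:C * z + (t 0 0 * t 0 1)%:C)) (t 0 0 ^+ 2).
    by apply: (upper_drifts _ N0 L0 t2 PN); exists q, n.
  exists L' => // z k z0.
  have E w : uhp w -> P (mobius u w) =
      P ((t 0 0 ^+ 2)%:C * w + (t 0 0 * t 0 1)%:C) + (P (mobius g 'i%C) - P 'i%C).
    move=> w0; rewrite ugt mobius_mul// -(mobius_upper w tS t10).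
    exact: Pcocycle Gg _ (mobius_uhp tS w0).
  rewrite !E//; last by rewrite natC; exact: uhpDreal.
  by rewrite HL'//; ring.
have [t [_ t0 [M M0 HM]]] := drifts_sum drift.
have {}t0 : 0 < t.
  apply: t0; exists (G `&` @SL2Z R) => //.
  exists (invmx (rep (G `&` @SL2Z R))) => //.
  have [h Gh E] := repX _ _ Hcs (conj G1 (SL2Z_1 R)).
  by rewrite -[invmx _]mulmx1 E mulKmx//; exact/SL2_unit/repS.
have : Phi ('i%C + (1 * M)%:R) = Phi 'i%C + (1 * M)%:R * (t%:C * c).
  exact: HM 'i%C 1%N (uhp_i R).
rewrite (Phi_periodic _ _ (uhp_i R)) => /eqP.
rewrite -{1}[Phi _]addr0 (inj_eq (addrI _)) eq_sym !mulf_eq0.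
move=> /orP[|/orP[|/eqP//]].
  by rewrite mul1n pnatr_eq0 eqn0Ngt M0.
by rewrite fmorph_eq0 gt_eqF.
Qed.

End ConstantTerm.

(** * Exponents, index sets and the duality *)

Section Duality.
Variable R : realType.
Local Notation C := R[i].
Local Notation normc := (@Normc.normc R).
Local Notation M2 := 'M[R]_2.
Implicit Types (G : set M2) (nu : M2 -> C) (x : rat).

Lemma conj_multiplierK nu : conj_multiplier (conj_multiplier nu) = nu.
Proof. by apply/funext => g; rewrite /conj_multiplier conjcK. Qed.

Lemma conjc_qpow1 x : conjc (qpow x 1) = qpow (- x) 1 :> C.
Proof.
rewrite /qpow /= !mulr0 !oppr0 !mulr1 expR0 rmorphN/= !mulrN cosN sinN.
by rewrite !mul0r !mul1r subr0 addr0.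
Qed.

(** Conjugation inverts [exp (2 pi i sh)], and shifts are normalised to lie in
    the interval from 0 included to 1 excluded, whence the case distinction. In
    the case of - T the powers of i match because i^(2(2 - k)) is the conjugate
    of i^(2k). *)
Lemma is_shift_conj k2 G nu w sh : is_shift (k2 : int) G nu w sh ->
  is_shift (4 - k2) G (conj_multiplier nu) w (if sh == 0 then 0 else 1 - sh).
Proof.
move=> [/andP[sh0 sh1] GT nGT].
have qE : qpow (if sh == 0 then 0 else 1 - sh) 1 = conjc (qpow sh 1) :> C.
  rewrite conjc_qpow1; case: eqP => [->|_]; first by rewrite oppr0.
  have one : (1 : rat) * 1%:R = 1%:~R by rewrite mulr1.
  rewrite qpowD (_ : qpow 1 1 = 1 :> C) ?mul1r//.
  have := @qpow_nat_period R _ _ _ 0 one; rewrite add0r => ->.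
  by rewrite qpow_cexp mulr0 cexp0.
split; rewrite ?qE.
- by case: eqP => [//|/eqP shn]; lra.
- by move=> /GT ->.
- move=> /nGT ->; rewrite rmorphM/=; congr (_ * _).
  rewrite fmorphXz/=.
  have iE : 'i%C * (0 -i* 1) = 1 :> C.
    by apply/eqP; rewrite eq_complex /=; apply/andP; split; apply/eqP; ring.
  have i0 : 'i%C != 0 :> C by rewrite eq_complex /= oner_eq0 andbF.
  have -> : (0 -i* 1) = 'i%C^-1 :> C by apply: (mulfI i0); rewrite mulfV.
  rewrite expfzDr// -exprz_inv.
  have -> : 'i%C ^ 4 = 1 :> C.
    by rewrite -[4]/(2 * 2)%N%:Z -exprnP exprM sqr_i sqrrN expr1n.
  by rewrite mul1r exprz_inv.
Qed.

(** One implication suffices, since passing to the weight 2 - k and the conjugate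
    multiplier is an involution. *)
Lemma exponents_conj (k2 : int) G nu x :
  exponents (4 - k2) G (conj_multiplier nu) x <-> exponents k2 G nu (- x).
Proof.
have half l mu y : exponents l G mu y ->
    exponents (4 - l) G (conj_multiplier mu) (- y).
  move=> [w [sh [n [ww /is_shift_conj + ->]]]]; case: eqP => [->|_] wsh.
    exists w, 0, (- n); split=> //.
    by rewrite -mulNr rmorphN/= !addr0.
  exists w, (1 - sh), (- n - 1); split=> //.
  by rewrite -mulNr rmorphB/= rmorphN/=; congr (_ / _); ring.
split=> [/half|/half]; last by rewrite opprK.
by rewrite conj_multiplierK subKr.
Qed.

Lemma exponents_width (k2 : int) G nu x :
  exponents k2 G nu x -> exists w, is_width G w.
Proof. by move=> [w [sh [n [? _ _]]]]; exists w. Qed.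

(** With this and the next lemma, Z^(nu) is the disjoint union of [- I] and [J].
    A negative exponent x lies in [- I], except when - x is an order of a dual
    cusp form, which puts x in J; a nonnegative x lies in J, except when x is an
    order of a holomorphic form, which puts x in [- I]. *)
Lemma index_sets_cover k2 G nu x : exponents (k2 : int) G nu x ->
  Iset k2 G nu (- x) \/ Jset (4 - k2) G (conj_multiplier nu) x.
Proof.
move=> xE; rewrite /Iset /Jset subKr conj_multiplierK.
have xE' : exponents (4 - k2) G (conj_multiplier nu) (- x).
  by apply/exponents_conj; rewrite opprK.
have [x0|x0] := ltP x 0.
  have [xJ|xJ] := pselect (Jtilde (4 - k2) G (conj_multiplier nu) (- x));
    [right|left].
    split; last by move=> -[[_]]; rewrite leNgt x0.
    by right; exists (- x); rewrite ?opprK.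
  by split=> //; left; split=> //=; rewrite oppr_gt0.
have [xI|xI] := pselect (Itilde k2 G nu x); [left|right]; split=> //.
- by right; exists x.
- by move=> -[[_ /=]]; rewrite oppr_gt0 ltNge x0.
- by left.
Qed.

Lemma index_sets_disjoint (k2 : int) G nu x :
  Iset k2 G nu (- x) -> Jset (4 - k2) G (conj_multiplier nu) x -> False.
Proof.
rewrite /Iset /Jset subKr conj_multiplierK => -[xI xnJ] [xJ xnI].
have {xI} x0 : x < 0.
  case: xI => [[_]|[y yI /oppr_inj yx]]; first by rewrite oppr_gt0.
  by case: xnI; rewrite -yx.
case: xJ => [[_]|[y yJ yx]]; first by rewrite leNgt x0.
by case: xnJ; rewrite -yx opprK.
Qed.

Lemma Iset_width k2 G nu m : Iset (k2 : int) G nu m -> exists w, is_width G w.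
Proof.
by move=> [[[/exponents_width]|[y [[/exponents_width]]]]].
Qed.

Lemma jfactor_SL2 (g : M2) z : SL2 g -> jfactor g z = cden g z.
Proof. by move=> gS; rewrite /jfactor gS sqrtr1 invr1 rmorph1 mul1r. Qed.

Lemma jpow_dual (k2 : int) (g : M2) z : SL2 g -> uhp z ->
  jpow k2 g z * jpow (4 - k2) g z = cden g z ^+ 2.
Proof.
move=> gS z0; rewrite /jpow jfactor_SL2//.
have s0 : sqrtc (cden g z) != 0 by rewrite sqrtc_eq0 cden_neq0.
rewrite -expfzDr// addrC subrK -[4]/(2 * 2)%N%:Z -exprnP exprM.
by rewrite sqr_sqrtc.
Qed.

(** Membership in the group of pairs of weight k prescribes the absolute value of
    [nu g * jpow k2 g z], which is already that of the second factor. *)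
Lemma multiplier_norm1 (k2 : int) G nu (g : M2) : G `<=` @SL2 R ->
  consistent_multiplier k2 G nu -> G g -> nu g * conj_multiplier nu g = 1.
Proof.
move=> GS [_ [sub _ _ _] _] Gg; have gS : SL2 g := GS _ Gg.
have [/= _ _ H] := sub _ (ex_intro2 _ _ g Gg erefl).
have := H _ (uhp_i R).
rewrite (gS : \det g = 1) powR1 mul1r normrM /jpow jfactor_SL2//.
have d0 := cden_neq0 gS (uhp_i R).
set d := cden g _ in d0 *; set s := sqrtc d.
have s0 : 0 < normc s by rewrite normc_gt0 sqrtc_eq0.
have ds : normc d = normc s ^+ 2 by rewrite -normcX sqr_sqrtc.
have -> : `|s ^ k2| = (normc s ^ k2)%:C.
  rewrite normC_normc; congr (_%:C).
  by case: (k2) => j; rewrite /exprz ?Normc.normcV normcX.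
have -> : complex.Re `|d| `^ wt R k2 = normc s ^ k2.
  have -> : complex.Re `|d| = normc s ^+ 2 by rewrite -ds normC_normc.
  rewrite -powR_mulrn ?ltW// -powRrM.
  rewrite /wt mulrCA mulfV ?pnatr_eq0// mulr1 powR_intmul// ltW//.
have sk0 : (normc s ^ k2)%:C != 0 :> C by rewrite fmorph_eq0 expfz_neq0// gt_eqF.
move=> E; rewrite /conj_multiplier -sqr_normc.
have -> : `|nu g| = 1 by apply: (mulIf sk0); rewrite mul1r.
by rewrite expr1n.
Qed.

Lemma modular_dual_product (k2 : int) G nu f h : G `<=` @SL2 R ->
  consistent_multiplier k2 G nu -> modular k2 G nu f ->
  modular (4 - k2) G (conj_multiplier nu) h ->
  forall g, G g -> forall z, uhp z ->
    f (mobius g z) * h (mobius g z) = cden g z ^+ 2 * (f z * h z).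
Proof.
move=> GS hnu fM hM g Gg z z0.
rewrite fM// hM// -(jpow_dual k2 (GS _ Gg) z0).
by rewrite (mulrACA (nu g * _)) (mulrACA (nu g)) (multiplier_norm1 GS hnu Gg) mul1r.
Qed.

Lemma slash_dual_product (k2 : int) f h (u : M2) z : SL2 u -> uhp z ->
  slash k2 f u z * slash (4 - k2) h u z =
  f (mobius u z) * h (mobius u z) * cden u z ^- 2.
Proof.
by move=> uS z0; rewrite /slash -(jpow_dual k2 uS z0) invfM mulrACA mulrC.
Qed.

Lemma SL2Z_cusp (u : M2) : SL2Z u ->
  exists s : option rat, mobius_bd u None = omap ratr s.
Proof.
move=> [_ uZ]; rewrite /mobius_bd.
have [_|u0] := eqVneq (u 1 0) 0; first by exists None.
have /intrP[a ->] := uZ 0 0; have /intrP[b ->] := uZ 1 0.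
by exists (Some (a%:~R / b%:~R)); rewrite /= fmorph_div /= !ratr_int.
Qed.

End Duality.

Theorem theorem1p1 (R : realType) (G : set 'M[R]_2) (k2 : int)
    (nu : 'M[R]_2 -> R[i])
    (hG : commensurable G)
    (hnu : consistent_multiplier k2 G nu)
    (hfin : finite_multiplier G nu)
    (f : rat -> R[i] -> R[i]) (a : rat -> rat -> R[i])
    (hf : canonical_basis (Minf k2 G nu) (exponents k2 G nu) (Iset k2 G nu) f a)
    (g : rat -> R[i] -> R[i]) (b : rat -> rat -> R[i])
    (hg : canonical_basis (Mhatinf (4 - k2) G (conj_multiplier nu))
            (exponents (4 - k2) G (conj_multiplier nu))
            (Jset (4 - k2) G (conj_multiplier nu)) g b)
    (m n : rat)
    (hm : Iset k2 G nu m)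
    (hn : Jset (4 - k2) G (conj_multiplier nu) n) :
  a m n = - b n m.
Proof.
have [GS _ _ _] := hG.
have [w wG] := Iset_width hm.
have [/(_ m hm) [[[_ fmod _] fcusp] [fexp fsupp]] _ _ _] := hf.
have [/(_ n hn) [[[[_ gmod _] _] gcusp] [gexp gsupp]] _ _ _] := hg.
have mn : n != - m.
  apply/eqP => nm; apply: (@index_sets_disjoint _ k2 G nu n) => //.
  by rewrite nm opprK.
have am : a m (- m) = 0.
  by apply/eqP/negPn/negP => /fsupp[_]; rewrite opprK.
have bn : b n (- n) = 0.
  by apply/eqP/negPn/negP => /gsupp[_]; rewrite opprK.
have [P [N [c [N0 PF PN cE]]]] := qexpansion_mul_primitive fexp gexp.
have c0 : c = 0.
  have Fmod := modular_dual_product GS hnu fmod gmod.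
  apply: (constant_term_weight2 hG wG Fmod PF N0 PN).
  move=> u uZ ninf; have [uS _] := uZ.
  have [s us] := SL2Z_cusp uZ.
  have nis : ~ infinite_cusp G s.
    by move=> [y Gy yE]; apply: ninf; exists y; rewrite ?us.
  have [A fA A0] := fcusp _ nis u uZ us.
  have [B gB B0] := gcusp _ nis u uZ us.
  have [Q [M [d [M0 QF QM dE]]]] := qexpansion_mul_primitive fA gB.
  have d0 : d = 0.
    rewrite (dE [::])// ?big_nil// => x; rewrite mulf_eq0 negb_or.
    move=> /andP[/A0 x0 /B0].
    by rewrite /= oppr_gt0 ltNge x0.
  exists Q, M; split=> // [z z0|z k z0]; last by rewrite QM// d0 mulr0 addr0.
  by rewrite -(slash_dual_product k2)//; exact: QF.
have {cE} := cE [:: - m; n]; rewrite c0 !big_cons big_nil addr0 opprK.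
have nm : (m == - n) = false by rewrite -eqr_oppLR eq_sym (negbTE mn).
rewrite !eqxx am bn (negbTE mn) nm.
rewrite !addr0 !add0r mul1r mulr1 => H.
apply/eqP; rewrite -addr_eq0 addrC; apply/eqP/esym/H.
  by rewrite /= inE eq_sym mn.
move=> x; rewrite !inE mulf_eq0 negb_or.
have [//|xm] := eqVneq x (- m); have [//|xn] := eqVneq x n; rewrite /= add0r.
rewrite eqr_opp (negbTE xn) add0r => /andP[/fsupp[xE xI] /gsupp[_]].
by rewrite opprK; case: (index_sets_cover xE).
Qed.
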